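(* Let $\mathfrak{L}$ be a solvable left Leibniz algebra over an algebraically closed field $\mathbb{F}$ of characteristic zero whose canonical Lie algebra $\mathfrak{L}_{\mathrm{Lie}}$ is finite dimensional. Then $$\mathrm{Gr}^{\mathrm{bi}}(\mathfrak{L})\cong\mathbb{Z}[\mathbb{F}^+\times\cdots\times\mathbb{F}^+]\circledast\mathbb{Z}[\mathbb{F}^+\times\cdots\times\mathbb{F}^+]$$ as unital commutative rings, where $\mathbb{F}^+$ denotes the additive group of $\mathbb{F}$ and the number of factors $\mathbb{F}^+$ in each of the group rings is $\dim_{\mathbb{F}}\mathfrak{L}_{\mathrm{Lie}}/[\mathfrak{L}_{\mathrm{Lie}},\mathfrak{L}_{\mathrm{Lie}}]$.
   Context: Rings are not assumed associative. A left Leibniz algebra is an $\mathbb{F}$-vector space $\mathfrak{L}$ with a bilinear multiplication satisfying $x(yz)=(xy)z+y(xz)$. It is solvable if its derived series $\mathfrak{L}^{(0)}=\mathfrak{L}$, $\mathfrak{L}^{(k+1)}=\mathfrak{L}^{(k)}\mathfrak{L}^{(k)}$ (spans of products) reaches $0$. Its canonical Lie algebra is $\mathfrak{L}_{\mathrm{Lie}}:=\mathfrak{L}/\mathrm{Leib}(\mathfrak{L})$, where $\mathrm{Leib}(\mathfrak{L}):=\langle x^2\mid x\in\mathfrak{L}\rangle_{\mathbb{F}}$ (an ideal). An $\mathfrak{L}$-bimodule is an $\mathbb{F}$-vector space $M$ with bilinear left and right $\mathfrak{L}$-actions satisfying, for all $x,y\in\mathfrak{L}$, $m\in M$: (LLM)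 $(xy)\cdot m=x\cdot(y\cdot m)-y\cdot(x\cdot m)$; (LML) $(x\cdot m)\cdot y=x\cdot(m\cdot y)-m\cdot(xy)$; (MLL) $(m\cdot x)\cdot y=m\cdot(xy)-x\cdot(m\cdot y)$. For $\mathfrak{L}$-bimodules $M,N$, the space $M\otimes N$ (over $\mathbb{F}$) carries the actions $x\cdot(m\otimes n):=(x\cdot m)\otimes n+m\otimes(x\cdot n)$ and $(m\otimes n)\cdot x:=(m\cdot x)\otimes n+m\otimes(n\cdot x)$. Let $T(M,N)$ be the smallest subspace of $M\otimes N$ closed under both actions and containing all elements $(x\cdot m+m\cdot x)\otimes(n\cdot y)+(m\cdot y)\otimes(x\cdot n+n\cdot x)$ with $x,y\in\mathfrak{L}$, $m\in M$, $n\in N$. The truncated tensor product $M\,\overline{\otimes}\,N:=(M\otimes N)/T(M,N)$ is an $\mathfrak{L}$-bimodule. $\mathrm{Gr}^{\mathrm{bi}}(\mathfrak{L})$ is the free abelian group on the set $\mathrm{Irr}^{\mathrm{bi}}(\mathfrak{L})$ of isomorphism classes of finite-dimensional irreducible $\mathfrak{L}$-bimodules; each finite-dimensional $\mathfrak{L}$-bimodule $X$ has a class $[X]:=\sum_{[L]}[X:L][L]$, where $[X:L]$ is the composition multiplicity. Its multiplication is the biadditive extension of $[M]\cdot[N]:=[M\,\overline{\otimes}\,N]$ for $[M],[N]\in\mathrm{Irr}^{\mathrm{bi}}(\mathfrak{L})$. It is commutative with unity the class of the one-dimensional trivial bimodule. Unital commutative product: let $A,B$ be unital commutative rings with free additive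 groups and chosen bases $A_1\ni 1_A$, $B_1\ni 1_B$ (for an integral group ring $\mathbb{Z}[G]$ the basis is $G$). Put $\widetilde{A}:=A_1\setminus\{1_A\}$, $\widetilde{B}:=B_1\setminus\{1_B\}$. Then $A\circledast B$ is the free abelian group on the disjoint union $\widetilde{A}\cup\widetilde{B}\cup\{1\}$ with biadditive multiplication $*$ given on basis elements by $a*a':=aa'$ for $a,a'\in\widetilde{A}$ and $b*b':=bb'$ for $b,b'\in\widetilde{B}$ (where $aa'$, $bb'$ are expanded in $A_1$, $B_1$ and $1_A$, $1_B$ are replaced by $1$), $a*b:=b*a:=0$ for $a\in\widetilde{A}$, $b\in\widetilde{B}$, and $1*x:=x*1:=x$. *)

(* Defs.v *)
From HB Require Import structures.
From mathcomp Require Import all_boot all_order all_algebra.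
From mathcomp Require Import boolp classical_sets.
From mathcomp Require Import ring freeg.

Set Implicit Arguments.
Unset Strict Implicit.
Unset Printing Implicit Defensive.

Import GRing.Theory VectorInternalTheory.
Local Open Scope ring_scope.

Section LinearSpan.
Variables (F : fieldType) (V : lmodType F).
Implicit Types (S : set V) (v : V).

Definition lspan S : set V := [set v | exists (n : nat) (c : 'I_n -> F)
  (s : 'I_n -> V), (forall i, S (s i)) /\ v = \sum_i c i *: s i].

Lemma lspan_incl S v : S v -> lspan S v.
Proof.
move=> Sv; exists 1%N, (fun _ => 1), (fun _ => v); split=> //.
by rewrite big_ord1 scale1r.
Qed.

Lemma lspan0 S : lspan S 0.
Proof.
exists 0%N, (fun _ => 0), (fun _ => 0); split; first by case.
by rewrite big_ord0.
Qed.

Lemma lspanZ S a v : lspan S v -> lspan S (a *: v).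
Proof.
case=> n [c [s [Ss ->]]]; exists n, (fun i => a * c i), s; split=> //.
by rewrite scaler_sumr; apply: eq_bigr => i _; rewrite scalerA.
Qed.

Lemma lspanD S u v : lspan S u -> lspan S v -> lspan S (u + v).
Proof.
case=> n [c [s [Ss ->]]] [m [d [t [St ->]]]].
exists (n + m)%N, (fun i => match split i with inl j => c j | inr j => d j end),
  (fun i => match split i with inl j => s j | inr j => t j end); split.
  by move=> i; case: split.
rewrite big_split_ord /=; congr (_ + _); apply: eq_bigr => i _.
  by rewrite (unsplitK (inl i)).
by rewrite (unsplitK (inr i)).
Qed.

Lemma lspanB S u v : lspan S u -> lspan S v -> lspan S (u - v).
Proof. by move=> Su Sv; rewrite -scaleN1r; apply/lspanD/lspanZ. Qed.

Lemma lspan_min S (P : set V) : P 0 -> (forall a u v, P u -> P v -> P (a *: u + v)) ->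
  (forall v, S v -> P v) -> forall v, lspan S v -> P v.
Proof.
move=> P0 PD SP v [n [c [s [Ss ->]]]]; apply: big_ind => //.
- by move=> x y Px Py; rewrite -[x]scale1r; apply: PD.
- by move=> i _; rewrite -[_ *: _]addr0; apply: PD => //; apply: SP.
Qed.

Definition lspanb S : pred V := fun v => `[< lspan S v >].

Lemma lspanb_zmod S : zmod_closed (lspanb S).
Proof.
split; first by apply/asboolP; exact: lspan0.
by move=> u v /asboolP Su /asboolP Sv; apply/asboolP; exact: lspanB.
Qed.

Definition lspan_closed S : zmodClosed V :=
  HB.pack (lspanb S) (GRing.isZmodClosed.Build V (lspanb S) (lspanb_zmod S)).

End LinearSpan.

(* The quotient space V / <S>. *)
Definition lquot (F : fieldType) (V : lmodType F) (S : set V) : Type :=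
  {ideal_quot (lspan_closed S)}.

Section LinearQuotient.
Variables (F : fieldType) (V : lmodType F) (S : set V).
Local Open Scope quotient_scope.

HB.instance Definition _ := GRing.Zmodule.on (lquot S).

Definition lpi (v : V) : lquot S := \pi_{ideal_quot (lspan_closed S)} v.

Lemma lpi_surj (q : lquot S) : exists v, lpi v = q.
Proof. by exists (repr (q : {ideal_quot (lspan_closed S)})); rewrite /lpi reprK. Qed.

Lemma lpiB : {morph lpi : u v / u - v}.
Proof. by move=> u v; rewrite /lpi raddfB. Qed.
Lemma lpiD : {morph lpi : u v / u + v}.
Proof. by move=> u v; rewrite /lpi raddfD. Qed.

Lemma lpi_eq (u v : V) : lpi u = lpi v <-> lspan S (u - v).
Proof.
split=> [/eqP|Suv]; rewrite /lpi.
  by rewrite -Quotient.idealrBE => /asboolP.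
by apply/eqP; rewrite -Quotient.idealrBE; apply/asboolP.
Qed.

Definition lquot_scale (a : F) (q : lquot S) : lquot S :=
  lpi (a *: repr (q : {ideal_quot (lspan_closed S)})).

Lemma lquot_scaleE a v : lquot_scale a (lpi v) = lpi (a *: v).
Proof.
apply/lpi_eq; rewrite -scalerBr; apply: lspanZ; apply/lpi_eq.
by rewrite /lpi reprK.
Qed.

Fact lquot_scaleA a b q : lquot_scale a (lquot_scale b q) = lquot_scale (a * b) q.
Proof. by case: (lpi_surj q) => v <-; rewrite !lquot_scaleE scalerA. Qed.
Fact lquot_scale1 : left_id 1 lquot_scale.
Proof. by move=> q; case: (lpi_surj q) => v <-; rewrite !lquot_scaleE scale1r. Qed.
Fact lquot_scaleDr : right_distributive lquot_scale +%R.
Proof.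
move=> a p q; case: (lpi_surj p) => u <-; case: (lpi_surj q) => v <-.
by rewrite -lpiD !lquot_scaleE -lpiD scalerDr.
Qed.
Fact lquot_scaleDl q : {morph lquot_scale^~ q : a b / a + b}.
Proof.
by move=> a b; case: (lpi_surj q) => v <-; rewrite !lquot_scaleE -lpiD scalerDl.
Qed.

HB.instance Definition _ := GRing.Zmodule_isLmodule.Build F (lquot S)
  lquot_scaleA lquot_scale1 lquot_scaleDr lquot_scaleDl.

Lemma lpi_linear : linear lpi.
Proof. by move=> a u v; rewrite lpiD -lquot_scaleE. Qed.

End LinearQuotient.

(* has_dim V n holds when V has a basis of n vectors; ldim V is meaningful
   only under findim V. *)
Definition has_dim (F : fieldType) (V : lmodType F) (n : nat) : Prop :=
  exists b : 'I_n -> V, forall v, exists! c : 'rV[F]_n, v = \sum_i c 0 i *: b i.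
Definition findim (F : fieldType) (V : lmodType F) : Prop := exists n, has_dim V n.
Definition ldim (F : fieldType) (V : lmodType F) : nat := xget 0%N [set n | has_dim V n].

HB.mixin Record isLeibniz (F : fieldType) L of GRing.Lmodule F L := {
  lbr : L -> L -> L;
  lbr_linl : forall y, linear (lbr^~ y);
  lbr_linr : forall x, linear (lbr x);
  lbr_leibniz : forall x y z, lbr x (lbr y z) = lbr (lbr x y) z + lbr y (lbr x z)
}.

#[short(type="leibnizType")]
HB.structure Definition Leibniz (F : fieldType) := {L of GRing.Lmodule F L & isLeibniz F L}.

Notation "x ∘ y" := (lbr x y) (at level 40, left associativity).

Section LeibnizTheory.
Variables (F : fieldType) (L : leibnizType F).
Implicit Types x y z : L.

Lemma lbrDl x y z : (x + y) ∘ z = x ∘ z + y ∘ z.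
Proof. by have := lbr_linl z 1 x y; rewrite /= !scale1r. Qed.
Lemma lbrDr x y z : z ∘ (x + y) = z ∘ x + z ∘ y.
Proof. by have := lbr_linr z 1 x y; rewrite !scale1r. Qed.
Lemma lbr0l z : 0 ∘ z = 0 :> L.
Proof. by apply: (addrI (0 ∘ z)); rewrite -lbrDl !addr0. Qed.
Lemma lbr0r z : z ∘ 0 = 0 :> L.
Proof. by apply: (addrI (z ∘ 0)); rewrite -lbrDr !addr0. Qed.
Lemma lbrZl a x z : (a *: x) ∘ z = a *: (x ∘ z).
Proof. by have := lbr_linl z a x 0; rewrite /= lbr0l !addr0. Qed.
Lemma lbrZr a x z : z ∘ (a *: x) = a *: (z ∘ x).
Proof. by have := lbr_linr z a x 0; rewrite lbr0r !addr0. Qed.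
Lemma lbrBl x y z : (x - y) ∘ z = x ∘ z - y ∘ z.
Proof. by rewrite -scaleN1r lbrDl lbrZl scaleN1r. Qed.
Lemma lbrBr x y z : z ∘ (x - y) = z ∘ x - z ∘ y.
Proof. by rewrite -scaleN1r lbrDr lbrZr scaleN1r. Qed.

Lemma lbr_squarel x z : (x ∘ x) ∘ z = 0.
Proof. by apply: (addIr (x ∘ (x ∘ z))); rewrite -lbr_leibniz add0r. Qed.

Definition products (S T : set L) : set L := [set z | exists x y, [/\ S x, T y & z = x ∘ y]].
Definition squares : set L := [set z | exists x, z = x ∘ x].

Fixpoint derived (k : nat) : set L :=
  if k is k'.+1 then lspan (products (derived k') (derived k')) else setT.

Definition solvable_leibniz : Prop := exists k, forall x, derived k x -> x = 0.

Lemma Leib_ideall u z : lspan squares u -> lspan squares (z ∘ u).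
Proof.
move: u; apply: lspan_min => [|a u v|_ [x ->]].
- by rewrite lbr0r; exact: lspan0.
- by rewrite lbrDr lbrZr => *; apply/lspanD => //; exact: lspanZ.
have -> : z ∘ (x ∘ x) =
    (x + z ∘ x) ∘ (x + z ∘ x) - x ∘ x - (z ∘ x) ∘ (z ∘ x).
  rewrite lbr_leibniz; set w := z ∘ x; rewrite lbrDl !lbrDr.
  rewrite addrA [_ + w ∘ w - _]addrAC addrK.
  by rewrite -[_ + _ + w ∘ x]addrA [x ∘ x + _]addrC addrK addrC.
by apply/lspanB; [apply/lspanB|]; apply: lspan_incl; eexists.
Qed.

Lemma Leib_idealr u z : lspan squares u -> lspan squares (u ∘ z).
Proof.
move: u; apply: lspan_min => [|a u v|_ [x ->]].
- by rewrite lbr0l; exact: lspan0.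
- by rewrite lbrDl lbrZl => *; apply/lspanD => //; exact: lspanZ.
by rewrite lbr_squarel; exact: lspan0.
Qed.

End LeibnizTheory.

Definition canonical_lie (F : fieldType) (L : leibnizType F) : Type := lquot (@squares F L).

Section CanonicalLie.
Variables (F : fieldType) (L : leibnizType F).
Local Notation g := (canonical_lie L).
Local Notation pi := (@lpi F L (@squares F L)).

HB.instance Definition _ := GRing.Lmodule.on g.

Definition lie_br (p q : g) : g :=
  pi (repr (p : {ideal_quot (lspan_closed (@squares F L))}) ∘ repr (q : {ideal_quot (lspan_closed (@squares F L))})).

Lemma lie_brE x y : lie_br (pi x) (pi y) = pi (x ∘ y).
Proof.
apply/lpi_eq; set x' := repr _; set y' := repr _.
have Hx : lspan (@squares F L) (x' - x) by apply/lpi_eq; rewrite /lpi reprK.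
have Hy : lspan (@squares F L) (y' - y) by apply/lpi_eq; rewrite /lpi reprK.
have -> : x' ∘ y' - x ∘ y = (x' - x) ∘ y' + x ∘ (y' - y).
  by rewrite lbrBl lbrBr addrA subrK.
by apply: lspanD; [exact: Leib_idealr | exact: Leib_ideall].
Qed.

Fact lie_br_linl q : linear (lie_br^~ q).
Proof.
move=> a p1 p2; case: (lpi_surj p1) => x <-; case: (lpi_surj p2) => y <-.
case: (lpi_surj q) => z <-; rewrite -lpi_linear !lie_brE -lpi_linear.
by rewrite lbrDl lbrZl.
Qed.
Fact lie_br_linr q : linear (lie_br q).
Proof.
move=> a p1 p2; case: (lpi_surj p1) => x <-; case: (lpi_surj p2) => y <-.
case: (lpi_surj q) => z <-; rewrite -lpi_linear !lie_brE -lpi_linear.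
by rewrite lbrDr lbrZr.
Qed.
Fact lie_br_leibniz p q r :
  lie_br p (lie_br q r) = lie_br (lie_br p q) r + lie_br q (lie_br p r).
Proof.
case: (lpi_surj p) => x <-; case: (lpi_surj q) => y <-; case: (lpi_surj r) => z <-.
by rewrite !lie_brE -lpiD lbr_leibniz.
Qed.

HB.instance Definition _ :=
  isLeibniz.Build F g lie_br_linl lie_br_linr lie_br_leibniz.

End CanonicalLie.

(* g / [g, g] *)
Definition abelianization (F : fieldType) (g : leibnizType F) : lmodType F :=
  lquot (products [set: g] [set: g]).

(* V / U is realized on a fixed complement of U. *)
Section SubspaceQuotient.
Variables (F : fieldType) (V : vectType F) (U : {vspace V}).

Definition vquot : vectType F := subvs_of (U^C)%VS.
Definition vpi (v : V) : vquot := vsproj (U^C)%VS (daddv_pi (U^C)%VS U v).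
Definition vlift (w : vquot) : V := vsval w.

Lemma capv_complC : (U^C :&: U = 0)%VS.
Proof. by rewrite capvC capv_compl. Qed.

Lemma vpi_linear : linear vpi.
Proof. by move=> a u v; rewrite /vpi !linearP. Qed.
Lemma vlift_linear : linear vlift.
Proof. by move=> a u v; rewrite /vlift linearP. Qed.
HB.instance Definition _ := GRing.isLinear.Build F V vquot _ vpi vpi_linear.
HB.instance Definition _ := GRing.isLinear.Build F vquot V _ vlift vlift_linear.

Lemma vliftK : cancel vlift vpi.
Proof.
move=> w; apply: val_inj; rewrite /= vsprojK ?memv_pi //.
by rewrite daddv_pi_id ?subvsP // capv_complC.
Qed.

Lemma vpiK v : v - vlift (vpi v) \in U.
Proof.
rewrite /vlift /vpi vsprojK ?memv_pi //.
have vC : v \in (U^C + U)%VS by rewrite addvC addv_complf memvf.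
rewrite -{1}(daddv_pi_add capv_complC vC).
by rewrite [X in X - _]addrC addrK memv_pi.
Qed.

Lemma vlift0 : vlift 0 = 0. Proof. exact: linear0. Qed.

Lemma vpi_eq0 v : (vpi v == 0) = (v \in U).
Proof.
apply/eqP/idP => [v0|Uv]; first by have := vpiK v; rewrite v0 vlift0 subr0.
have lU : vlift (vpi v) \in U by have := rpredB Uv (vpiK v); rewrite opprB addrC subrK.
have : vlift (vpi v) \in (U^C :&: U)%VS by rewrite memv_cap lU subvsP.
by rewrite capv_complC memv0 => /eqP v0; rewrite -[vpi v]vliftK [vlift _]v0 linear0.
Qed.

End SubspaceQuotient.

(* M ⊗ N in coordinates: u ⊗ v is the matrix of products of coordinates. *)
Section Tensor.
Variable F : fieldType.
Implicit Types M N W : vectType F.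

Definition tensor M N : vectType F := 'M[F]_(dim M, dim N).

Definition tens M N (u : M) (v : N) : tensor M N := (v2r u)^T *m v2r v.

Definition stdb M (i : 'I_(dim M)) : M := r2v (delta_mx 0 i).

(* The linear map M ⊗ N -> W induced by a bilinear map B. *)
Definition tlift M N W (B : M -> N -> W) (t : tensor M N) : W :=
  \sum_i \sum_j (t : 'M_(_, _)) i j *: B (stdb i) (stdb j).

Lemma tlift_linear M N W (B : M -> N -> W) : linear (tlift B).
Proof.
move=> a s t; rewrite /tlift scaler_sumr -big_split; apply: eq_bigr => i _.
rewrite scaler_sumr -big_split; apply: eq_bigr => j _ /=.
by rewrite !mxE scalerDl scalerA.
Qed.
HB.instance Definition _ M N W (B : M -> N -> W) :=
  GRing.isLinear.Build F (tensor M N) W _ (tlift B) (tlift_linear B).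

Lemma stdb_sum M (u : M) : u = \sum_i v2r u 0 i *: stdb i.
Proof.
apply: v2r_inj; rewrite linear_sum {1}[v2r u]row_sum_delta.
by apply: eq_bigr => i _; rewrite linearZ /= r2vK.
Qed.

Lemma linear_fsum (V W : lmodType F) (f : V -> W) (I : finType) (c : I -> F) (v : I -> V) :
  linear f -> f (\sum_i c i *: v i) = \sum_i c i *: f (v i).
Proof.
move=> lf; pose g : {linear V -> W} := HB.pack f (GRing.isLinear.Build F V W _ f lf).
by rewrite -[f]/(g : V -> W) linear_sum; apply: eq_bigr => i _; rewrite linearZ.
Qed.

Lemma tlift_tens M N W (B : M -> N -> W) u v :
  (forall n, linear (B^~ n)) -> (forall m, linear (B m)) ->
  tlift B (tens u v) = B u v.
Proof.
move=> lB rB; rewrite [in RHS](stdb_sum u) [in RHS](stdb_sum v).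
rewrite (linear_fsum _ _ (lB _)); apply: eq_bigr => i _.
rewrite (linear_fsum _ _ (rB _)) scaler_sumr; apply: eq_bigr => j _.
by rewrite mxE big_ord1 mxE scalerA.
Qed.

Lemma tens_linl M N (v : N) : linear ((@tens M N)^~ v).
Proof. by move=> a x y; rewrite /tens !linearP /= mulmxDl -scalemxAl. Qed.
Lemma tens_linr M N (u : M) : linear (@tens M N u).
Proof. by move=> a x y; rewrite /tens !linearP. Qed.

Lemma tensZl M N a (u : M) (v : N) : tens (a *: u) v = a *: tens u v.
Proof. by rewrite /tens !linearZ /= -scalemxAl. Qed.
Lemma tensZr M N a (u : M) (v : N) : tens u (a *: v) = a *: tens u v.
Proof. by rewrite /tens !linearZ. Qed.

Lemma tens_ext M N W (f g : {linear tensor M N -> W}) :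
  (forall u v, f (tens u v) = g (tens u v)) -> f =1 g.
Proof.
move=> fg t; rewrite [t](matrix_sum_delta (t : 'M_(_, _))) !linear_sum.
apply: eq_bigr => i _; rewrite !linear_sum; apply: eq_bigr => j _; rewrite !linearZ /=.
congr (_ *: _); have := fg (stdb i) (stdb j).
by rewrite /tens /stdb !r2vK trmx_delta mul_delta_mx.
Qed.

End Tensor.

(* An L-bimodule structure on the finite-dimensional space V. *)
Record bimod_on (F : fieldType) (L : leibnizType F) (V : vectType F) := BimodOn {
  lact_on : L -> V -> V;
  ract_on : V -> L -> V;
  lact_on_linl : forall m, linear (lact_on^~ m);
  lact_on_linr : forall x, linear (lact_on x);
  ract_on_linl : forall x, linear (ract_on^~ x);
  ract_on_linr : forall m, linear (ract_on m);
  bimod_on_LLM : forall x y m,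
    lact_on (x ∘ y) m = lact_on x (lact_on y m) - lact_on y (lact_on x m);
  bimod_on_LML : forall x y m,
    ract_on (lact_on x m) y = lact_on x (ract_on m y) - ract_on m (x ∘ y);
  bimod_on_MLL : forall x y m,
    ract_on (ract_on m x) y = ract_on m (x ∘ y) - lact_on x (ract_on m y)
}.

Record bimod (F : fieldType) (L : leibnizType F) := Bimod {
  bcar :> vectType F;
  bstr : bimod_on L bcar
}.

Definition lact (F : fieldType) (L : leibnizType F) (M : bimod L) (x : L) (m : M) : M :=
  lact_on (bstr M) x m.
Definition ract (F : fieldType) (L : leibnizType F) (M : bimod L) (m : M) (x : L) : M :=
  ract_on (bstr M) m x.

Notation "x ▷ m" := (lact x m) (at level 40, m at next level).
Notation "m ◁ x" := (ract m x) (at level 40, left associativity).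

Section BimoduleLinear.
Variables (F : fieldType) (L : leibnizType F) (M : bimod L).
Implicit Types (x y : L) (m : M).

Lemma lact_linl m : linear ((@lact F L M)^~ m).
Proof. exact: lact_on_linl. Qed.
Lemma lact_linr x : linear (@lact F L M x).
Proof. exact: lact_on_linr. Qed.
Lemma ract_linl x : linear ((@ract F L M)^~ x).
Proof. exact: ract_on_linl. Qed.
Lemma ract_linr m : linear (@ract F L M m).
Proof. exact: ract_on_linr. Qed.
Lemma bimod_LLM x y m : (x ∘ y) ▷ m = x ▷ (y ▷ m) - y ▷ (x ▷ m).
Proof. exact: bimod_on_LLM. Qed.
Lemma bimod_LML x y m : (x ▷ m) ◁ y = x ▷ (m ◁ y) - m ◁ (x ∘ y).
Proof. exact: bimod_on_LML. Qed.
Lemma bimod_MLL x y m : (m ◁ x) ◁ y = m ◁ (x ∘ y) - x ▷ (m ◁ y).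
Proof. exact: bimod_on_MLL. Qed.

HB.instance Definition _ (x : L) :=
  GRing.isLinear.Build F M M _ (@lact F L M x) (lact_linr x).
Definition ractr (x : L) (m : M) : M := m ◁ x.
HB.instance Definition _ (x : L) :=
  GRing.isLinear.Build F M M _ (ractr x) (ract_linl x).

Lemma ractD x (m n : M) : (m + n) ◁ x = m ◁ x + n ◁ x.
Proof. exact: (linearD (ractr x)). Qed.
Lemma ract0 x : (0 : M) ◁ x = 0.
Proof. exact: (linear0 (ractr x)). Qed.
End BimoduleLinear.

Section BimoduleTheory.
Variables (F : fieldType) (L : leibnizType F).
Implicit Types M N X Y : bimod L.

Definition subbimod M (U : {vspace M}) : Prop :=
  forall x m, m \in U -> x ▷ m \in U /\ m ◁ x \in U.

Definition irreducible M : Prop :=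
  (fullv : {vspace M}) <> 0%VS /\
  forall U : {vspace M}, subbimod U -> U = 0%VS \/ U = fullv.

Definition iso_bimod M N : Prop := exists f : 'Hom(M, N),
  [/\ bijective f, forall x m, f (x ▷ m) = x ▷ f m & forall x m, f (m ◁ x) = f m ◁ x].

Lemma iso_bimod_refl M : iso_bimod M M.
Proof.
exists \1%VF; split=> [|x m|x m]; rewrite ?lfunE //.
by exists \1%VF => m; rewrite !lfunE.
Qed.

Lemma iso_bimod_sym M N : iso_bimod M N -> iso_bimod N M.
Proof.
case=> f [[g fK gK] fl fr].
have lf : lker f == 0%VS by apply/lker0P; exact: can_inj fK.
have gE n : (f^-1)%VF n = g n by rewrite -{1}(gK n) lker0_lfunK.
exists (f^-1)%VF; split=> [|x n|x n].
- by exists f => n; rewrite gE ?fK ?gK.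
- by rewrite !gE; apply: (can_inj fK); rewrite fl !gK.
- by rewrite !gE; apply: (can_inj fK); rewrite fr !gK.
Qed.

Lemma iso_bimod_trans M N X : iso_bimod M N -> iso_bimod N X -> iso_bimod M X.
Proof.
case=> f [bf fl fr] [g [bg gl gr]]; exists (g \o f)%VF; split=> [|x m|x m].
- by apply: (eq_bij (bij_comp bg bf)) => m; rewrite /= comp_lfunE.
- by rewrite !comp_lfunE fl gl.
- by rewrite !comp_lfunE fr gr.
Qed.

Section Truncated.
Variables M N : bimod L.

Definition tlact (x : L) : tensor M N -> tensor M N :=
  tlift (fun m n => tens (x ▷ m) n + tens m (x ▷ n)).
Definition tract (t : tensor M N) (x : L) : tensor M N :=
  tlift (fun m n => tens (m ◁ x) n + tens m (n ◁ x)) t.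

Definition tclosed (U : {vspace tensor M N}) : Prop :=
  (forall x t, t \in U -> tlact x t \in U /\ tract t x \in U) /\
  (forall x y m n, tens (x ▷ m + m ◁ x) (n ◁ y) + tens (m ◁ y) (x ▷ n + n ◁ x) \in U).

Definition smallest_tclosed (U : {vspace tensor M N}) : Prop :=
  tclosed U /\ forall U', tclosed U' -> (U <= U')%VS.

(* T(M, N); the default value is never used, by truncT_spec. *)
Definition truncT : {vspace tensor M N} := xget 0%VS [set U | smallest_tclosed U].

Lemma tclosed_cap U V : tclosed U -> tclosed V -> tclosed (U :&: V)%VS.
Proof.
move=> [Uc Ug] [Vc Vg]; split=> [x t|x y m n]; rewrite ?memv_cap ?Ug ?Vg //.
by case/andP=> /(Uc x)[-> ->] /(Vc x)[-> ->].
Qed.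

Lemma truncT_spec : smallest_tclosed truncT.
Proof.
suff [U HU] : exists U, smallest_tclosed U by apply: (@xgetPex _ 0%VS _ (ex_intro _ U HU)).
pose P k := `[< exists U, tclosed U /\ \dim U = k >].
have exP : exists k, P k.
  exists (\dim (fullv : {vspace tensor M N})); apply/asboolP; exists fullv.
  by split=> //; split=> *; rewrite ?memvf.
case: (ex_minnP exP) => k /asboolP[U [cU dU]] kmin; exists U; split=> // V cV.
have le : (k <= \dim (U :&: V))%N.
  by apply: kmin; apply/asboolP; exists (U :&: V)%VS; split=> //; exact: tclosed_cap.
have /eqP <- : (U :&: V == U)%VS by rewrite eqEdim capvSl dU.
exact: capvSr.
Qed.

Fact tbl1 x (n : N) : linear (fun m : M => tens (x ▷ m) n + tens m (x ▷ n)).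
Proof.
by move=> a u v; rewrite linearP !tens_linl scalerDr addrACA.
Qed.
Fact tbl2 x (m : M) : linear (fun n : N => tens (x ▷ m) n + tens m (x ▷ n)).
Proof. by move=> a u v; rewrite linearP !tens_linr scalerDr addrACA. Qed.
Fact tbr1 x (n : N) : linear (fun m : M => tens (m ◁ x) n + tens m (n ◁ x)).
Proof. by move=> a u v; rewrite ract_linl !tens_linl scalerDr addrACA. Qed.
Fact tbr2 x (m : M) : linear (fun n : N => tens (m ◁ x) n + tens m (n ◁ x)).
Proof. by move=> a u v; rewrite ract_linl !tens_linr scalerDr addrACA. Qed.

Lemma tlact_tens x m n : tlact x (tens m n) = tens (x ▷ m) n + tens m (x ▷ n).
Proof. exact: (tlift_tens m n (tbl1 x) (tbl2 x)). Qed.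
Lemma tract_tens x m n : tract (tens m n) x = tens (m ◁ x) n + tens m (n ◁ x).
Proof. exact: (tlift_tens m n (tbr1 x) (tbr2 x)). Qed.

End Truncated.
End BimoduleTheory.

Section TruncatedBimodule.
Variables (F : fieldType) (L : leibnizType F) (M N : bimod L).
Local Notation T := (truncT M N).
Local Notation q := (vpi T).

Definition tractr (x : L) (t : tensor M N) : tensor M N := tract t x.
HB.instance Definition _ (x : L) := GRing.isLinear.Build F (tensor M N)
  (tensor M N) _ (@tlact F L M N x) (tlift_linear _).
HB.instance Definition _ (x : L) := GRing.isLinear.Build F (tensor M N)
  (tensor M N) _ (tractr x) (tlift_linear _).

Lemma tlactP a x y (t : tensor M N) : tlact (a *: x + y) t = a *: tlact x t + tlact y t.
Proof.
apply: (tens_ext (f := @tlact _ _ M N _) (g := (a \*: @tlact _ _ M N x) \+ @tlact _ _ M N y)) => u v /=.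
by rewrite !tlact_tens !lact_linl tens_linl tens_linr scalerDr addrACA.
Qed.
Lemma tractP a x y (t : tensor M N) : tract t (a *: x + y) = a *: tract t x + tract t y.
Proof.
apply: (tens_ext (f := tractr _) (g := (a \*: tractr x) \+ tractr y)) => u v /=.
by rewrite /tractr !tract_tens !ract_linr tens_linl tens_linr scalerDr addrACA.
Qed.

Lemma tensDl (u v : M) (w : N) : tens (u + v) w = tens u w + tens v w.
Proof. by have := tens_linl w 1 u v; rewrite !scale1r. Qed.
Lemma tensDr (w : M) (u v : N) : tens w (u + v) = tens w u + tens w v.
Proof. by have := tens_linr w 1 u v; rewrite !scale1r. Qed.
Lemma tensBl (u v : M) (w : N) : tens (u - v) w = tens u w - tens v w.
Proof. by rewrite -scaleN1r addrC tens_linl scaleN1r addrC. Qed.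
Lemma tensBr (w : M) (u v : N) : tens w (u - v) = tens w u - tens w v.
Proof. by rewrite -scaleN1r addrC tens_linr scaleN1r addrC. Qed.

Lemma tlact_LLM x y (t : tensor M N) :
  tlact (x ∘ y) t = tlact x (tlact y t) - tlact y (tlact x t).
Proof.
apply: (tens_ext (f := @tlact _ _ M N _) (g := (@tlact _ _ M N x \o @tlact _ _ M N y) \-
  (@tlact _ _ M N y \o @tlact _ _ M N x))) => u v /=.
rewrite !tlact_tens !linearD /= !tlact_tens !bimod_LLM tensBl tensBr.
move: (tens (x ▷ (y ▷ u)) v) (tens (y ▷ (x ▷ u)) v) (tens (y ▷ u) (x ▷ v))
  (tens (x ▷ u) (y ▷ v)) (tens u (x ▷ (y ▷ v))) (tens u (y ▷ (x ▷ v))).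
move=> a b c d e f; apply/matrixP => i j; rewrite !mxE.
move: (a i j) (b i j) (c i j) (d i j) (e i j) (f i j) => {}a {}b {}c {}d {}e {}f; ring.
Qed.

Lemma tlact_LML x y (t : tensor M N) :
  tract (tlact x t) y = tlact x (tract t y) - tract t (x ∘ y).
Proof.
apply: (tens_ext (f := tractr y \o @tlact _ _ M N x)
  (g := (@tlact _ _ M N x \o tractr y) \- tractr (x ∘ y))) => u v /=.
rewrite /tractr tlact_tens !tract_tens -!/(tractr _ _) !linearD /= /tractr.
rewrite !tract_tens !tlact_tens !bimod_LML tensBl tensBr.
move: (tens (x ▷ (u ◁ y)) v) (tens (u ◁ (x ∘ y)) v) (tens (x ▷ u) (v ◁ y))
  (tens (u ◁ y) (x ▷ v)) (tens u (x ▷ (v ◁ y))) (tens u (v ◁ (x ∘ y))).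
move=> a b c d e f; apply/matrixP => i j; rewrite !mxE.
move: (a i j) (b i j) (c i j) (d i j) (e i j) (f i j) => {}a {}b {}c {}d {}e {}f; ring.
Qed.

Lemma tlact_MLL x y (t : tensor M N) :
  q (tract (tract t x) y) = q (tract t (x ∘ y) - tlact x (tract t y)).
Proof.
apply: (tens_ext (f := q \o (tractr y \o tractr x))
  (g := q \o (tractr (x ∘ y) \- (@tlact _ _ M N x \o tractr y)))) => u v /=.
apply/eqP; rewrite -subr_eq0 -linearB vpi_eq0.
have [[_ gT] _] := truncT_spec M N; have := gT x y u v.
rewrite /tractr !tract_tens -!/(tractr _ _) !linearD /= /tractr.
rewrite !tract_tens !tlact_tens !bimod_MLL !tensBl !tensBr !tensDl !tensDr.
move: (tens (x ▷ u) _) (tens (u ◁ x) _) (tens (u ◁ y) (x ▷ v)) (tens (u ◁ y) (v ◁ x))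
  (tens (u ◁ (x ∘ y)) v) (tens (x ▷ (u ◁ y)) v) (tens u (v ◁ (x ∘ y))) (tens u (x ▷ (v ◁ y))).
move=> a b c d e f g h.
have memE (s s' : tensor M N) : s = s' -> s \in T -> s' \in T by move->.
apply: memE; apply/matrixP => i j; rewrite !mxE.
move: (a i j) (b i j) (c i j) (d i j) (e i j) (f i j) (g i j) (h i j).
move=> {}a {}b {}c {}d {}e {}f {}g {}h; ring.
Qed.

Definition qlact (x : L) (w : vquot T) : vquot T := q (tlact x (vlift w)).
Definition qract (w : vquot T) (x : L) : vquot T := q (tract (vlift w) x).

Lemma qlactE x t : qlact x (q t) = q (tlact x t).
Proof.
apply/eqP; rewrite -subr_eq0 /qlact -linearB vpi_eq0 -linearB.
have [[cT _] _] := truncT_spec M N.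
by have /(cT x)[] : vlift (q t) - t \in T by rewrite -memvN opprB vpiK.
Qed.
Lemma qractE x t : qract (q t) x = q (tract t x).
Proof.
apply/eqP; rewrite -subr_eq0 /qract -linearB vpi_eq0 -!/(tractr _ _) -linearB.
have [[cT _] _] := truncT_spec M N.
by have /(cT x)[] : vlift (q t) - t \in T by rewrite -memvN opprB vpiK.
Qed.

Fact qlact_linl w : linear (qlact^~ w).
Proof. by move=> a x y; rewrite /qlact tlactP linearP. Qed.
Fact qlact_linr x : linear (qlact x).
Proof. by move=> a v w; rewrite /qlact !linearP. Qed.
Fact qract_linl x : linear (qract^~ x).
Proof. by move=> a v w; rewrite /qract -!/(tractr _ _) !linearP. Qed.
Fact qract_linr w : linear (qract w).
Proof. by move=> a x y; rewrite /qract tractP linearP. Qed.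
Fact qact_LLM x y w : qlact (x ∘ y) w = qlact x (qlact y w) - qlact y (qlact x w).
Proof. by rewrite -(vliftK w) !qlactE -linearB tlact_LLM. Qed.
Fact qact_LML x y w : qract (qlact x w) y = qlact x (qract w y) - qract w (x ∘ y).
Proof. by rewrite -(vliftK w) !(qlactE, qractE) -linearB tlact_LML. Qed.
Fact qact_MLL x y w : qract (qract w x) y = qract w (x ∘ y) - qlact x (qract w y).
Proof. by rewrite -(vliftK w) !(qlactE, qractE) -linearB tlact_MLL. Qed.

(* M ⊗̄ N = (M ⊗ N) / T(M, N) *)
Definition trunc_tensor : bimod L :=
  Bimod (BimodOn qlact_linl qlact_linr qract_linl qract_linr qact_LLM qact_LML qact_MLL).

End TruncatedBimodule.

Section TruncatedIso.
Variables (F : fieldType) (L : leibnizType F).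

Definition equivariant (M N M' N' : bimod L) (f : tensor M N -> tensor M' N') :=
  forall x t, f (tlact x t) = tlact x (f t) /\ f (tract t x) = tract (f t) x.

Definition sends_gens (M N M' N' : bimod L) (f : tensor M N -> tensor M' N') :=
  forall x y m n, f (tens (x ▷ m + m ◁ x) (n ◁ y) + tens (m ◁ y) (x ▷ n + n ◁ x))
    \in truncT M' N'.

Lemma truncT_sub (M N M' N' : bimod L) (f : {linear tensor M N -> tensor M' N'}) :
  equivariant f -> sends_gens f -> forall t, t \in truncT M N -> f t \in truncT M' N'.
Proof.
move=> fe fg; have [_ Tmin] := truncT_spec M N; have [[cT _] _] := truncT_spec M' N'.
have /Tmin/subvP sub : tclosed (linfun f @^-1: truncT M' N')%VS.
  split=> [x t|x y m n]; rewrite -!memv_preim !lfunE; last exact: (fg x y m n).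
  by case: (fe x t) => -> ->; apply: cT.
by move=> t /sub; rewrite -memv_preim lfunE.
Qed.

Lemma trunc_iso (M N M' N' : bimod L) (f : {linear tensor M N -> tensor M' N'})
    (g : {linear tensor M' N' -> tensor M N}) :
  cancel f g -> cancel g f -> equivariant f -> sends_gens f -> sends_gens g ->
  iso_bimod (trunc_tensor M N) (trunc_tensor M' N').
Proof.
move=> fK gK fe fg gg.
have ge : equivariant g.
  by move=> x t; split; apply: (can_inj fK); rewrite gK; case: (fe x (g t)) => h1 h2;
     rewrite ?h1 ?h2 gK.
have fT := truncT_sub fe fg; have gT := truncT_sub ge gg.
pose h : {linear vquot (truncT M N) -> vquot (truncT M' N')} :=
  vpi (truncT M' N') \o (f \o @vlift _ _ (truncT M N)).
pose k : {linear vquot (truncT M' N') -> vquot (truncT M N)} :=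
  vpi (truncT M N) \o (g \o @vlift _ _ (truncT M' N')).
have hE t : h (vpi _ t) = vpi _ (f t).
  apply/eqP; rewrite -subr_eq0 /h /= -linearB vpi_eq0 -linearB fT //.
  by rewrite -memvN opprB vpiK.
have kE t : k (vpi _ t) = vpi _ (g t).
  apply/eqP; rewrite -subr_eq0 /k /= -linearB vpi_eq0 -linearB gT //.
  by rewrite -memvN opprB vpiK.
exists (linfun h : 'Hom(trunc_tensor M N, trunc_tensor M' N')); split.
- exists k => w; rewrite lfunE -{1}[w]vliftK.
    by rewrite (hE (vlift w)) kE fK vliftK.
  by rewrite (kE (vlift w)) hE gK vliftK.
- move=> x w; rewrite !lfunE.
  change (h (vpi _ (tlact x (vlift w))) = qlact x (vpi _ (f (vlift w)))).
  by rewrite hE qlactE (proj1 (fe x _)).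
- move=> x w; rewrite !lfunE.
  change (h (vpi _ (tract (vlift w) x)) = qract (vpi _ (f (vlift w))) x).
  by rewrite hE qractE (proj2 (fe x _)).
Qed.

Lemma tlift_map_lin (M N M' N' : vectType F) (f : 'Hom(M, M')) (g : 'Hom(N, N')) :
  (forall n, linear (fun m => tens (f m) (g n))) /\
  (forall m, linear (fun n => tens (f m) (g n))).
Proof.
split=> m a u v; first by rewrite linearP tens_linl.
by rewrite linearP tens_linr.
Qed.

Definition tmap (M N M' N' : vectType F) (f : 'Hom(M, M')) (g : 'Hom(N, N')) :=
  tlift (fun m n => tens (f m) (g n)).
HB.instance Definition _ M N M' N' f g := GRing.isLinear.Build F (tensor M N) (tensor M' N')
  _ (@tmap M N M' N' f g) (tlift_linear _).

Lemma tmapE (M N M' N' : vectType F) (f : 'Hom(M, M')) (g : 'Hom(N, N')) m n :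
  tmap f g (tens m n) = tens (f m) (g n).
Proof. by case: (tlift_map_lin f g) => l r; apply: (tlift_tens m n l r). Qed.

Lemma tmapK (M N M' N' : vectType F) (f : 'Hom(M, M')) (g : 'Hom(N, N'))
    (f' : 'Hom(M', M)) (g' : 'Hom(N', N)) :
  cancel f f' -> cancel g g' -> cancel (tmap f g) (tmap f' g').
Proof.
move=> fK gK; apply: (tens_ext (f := tmap f' g' \o tmap f g) (g := idfun)) => u v /=.
by rewrite !tmapE fK gK.
Qed.

Lemma tmap_equivariant (M N M' N' : bimod L) (f : 'Hom(M, M')) (g : 'Hom(N, N')) :
  (forall x m, f (x ▷ m) = x ▷ f m /\ f (m ◁ x) = f m ◁ x) ->
  (forall x m, g (x ▷ m) = x ▷ g m /\ g (m ◁ x) = g m ◁ x) ->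
  equivariant (tmap f g).
Proof.
move=> fe ge x; have fl m := proj1 (fe x m); have fr m := proj2 (fe x m).
have gl m := proj1 (ge x m); have gr m := proj2 (ge x m).
move=> t; split.
  apply: (tens_ext (f := tmap f g \o @tlact _ _ M N x) (g := @tlact _ _ M' N' x \o tmap f g)) => u v /=.
  by rewrite tlact_tens linearD /= !tmapE tlact_tens fl gl.
apply: (tens_ext (f := tmap f g \o @tractr _ _ M N x) (g := @tractr _ _ M' N' x \o tmap f g)) => u v /=.
by rewrite /tractr tract_tens linearD /= !tmapE tract_tens fr gr.
Qed.

Lemma tmap_gens (M N M' N' : bimod L) (f : 'Hom(M, M')) (g : 'Hom(N, N')) :
  (forall x m, f (x ▷ m) = x ▷ f m /\ f (m ◁ x) = f m ◁ x) ->
  (forall x m, g (x ▷ m) = x ▷ g m /\ g (m ◁ x) = g m ◁ x) ->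
  sends_gens (tmap f g).
Proof.
move=> fe ge x y m n; rewrite linearD /= !tmapE !linearD /=.
have [-> ->] := fe x m; have [_ ->] := fe y m.
have [-> ->] := ge x n; have [_ ->] := ge y n.
by have [[_ gT] _] := truncT_spec M' N'.
Qed.

Lemma trunc_tensor_iso (M N M' N' : bimod L) :
  iso_bimod M M' -> iso_bimod N N' -> iso_bimod (trunc_tensor M N) (trunc_tensor M' N').
Proof.
have inv (X Y : bimod L) : iso_bimod X Y -> exists (f : 'Hom(X, Y)) (g : 'Hom(Y, X)),
    [/\ cancel f g, cancel g f,
    (forall x m, f (x ▷ m) = x ▷ f m /\ f (m ◁ x) = f m ◁ x) &
    (forall x m, g (x ▷ m) = x ▷ g m /\ g (m ◁ x) = g m ◁ x)].
  case=> f [[h fK hK] fl fr]; have lf : lker f == 0%VS by apply/lker0P; exact: can_inj fK.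
  have gE n : (f^-1)%VF n = h n by rewrite -{1}(hK n) lker0_lfunK.
  exists f, (f^-1)%VF; split=> // [m|m|x m]; rewrite ?gE ?fK ?hK //.
  by split; apply: (can_inj fK); rewrite ?fl ?fr !hK.
move=> /inv[f [f' [fK f'K fe f'e]]] /inv[g [g' [gK g'K ge g'e]]].
apply: (trunc_iso (f := tmap f g) (g := tmap f' g')).
- exact: tmapK.
- exact: tmapK.
- exact: tmap_equivariant.
- exact: tmap_gens.
- exact: tmap_gens.
Qed.

Definition tflip (M N : vectType F) : tensor M N -> tensor N M := @trmx F (dim M) (dim N).
HB.instance Definition _ M N := GRing.isLinear.Build F (tensor M N) (tensor N M)
  _ (@tflip M N) (@linearP _ _ _ _ (@trmx F (dim M) (dim N))).

Lemma tflipE (M N : vectType F) (u : M) (v : N) : tflip (tens u v) = tens v u.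
Proof. by rewrite /tflip /tens trmx_mul trmxK. Qed.

Lemma tflip_gens (M N : bimod L) : sends_gens (@tflip M N).
Proof.
move=> x y m n; rewrite linearD /= !tflipE addrC.
by have [[_ gT] _] := truncT_spec N M.
Qed.

Lemma trunc_tensorC (M N : bimod L) : iso_bimod (trunc_tensor M N) (trunc_tensor N M).
Proof.
apply: (trunc_iso (f := @tflip M N) (g := @tflip N M)); try exact: trmxK.
- move=> x t; split.
    apply: (tens_ext (f := @tflip M N \o @tlact _ _ M N x) (g := @tlact _ _ N M x \o @tflip M N)) => u v /=.
    by rewrite tlact_tens linearD /= !tflipE tlact_tens addrC.
  apply: (tens_ext (f := @tflip M N \o @tractr _ _ M N x) (g := @tractr _ _ N M x \o @tflip M N)) => u v /=.
  by rewrite /tractr tract_tens linearD /= !tflipE tract_tens addrC.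
- exact: tflip_gens.
- exact: tflip_gens.
Qed.

Section TrivialBimodule.
Variable V : vectType F.
Fact triv_lin (W : lmodType F) : linear (fun _ : W => 0 : V).
Proof. by move=> a u v; rewrite scaler0 addr0. Qed.
Fact triv_eq (x y : L) (m : V) : 0 = 0 - 0 :> V.
Proof. by rewrite subr0. Qed.
Definition triv_on : bimod_on L V := @BimodOn F L V (fun _ _ => 0) (fun _ _ => 0)
  (fun _ => @triv_lin L) (fun _ => @triv_lin V) (fun _ => @triv_lin V) (fun _ => @triv_lin L)
  triv_eq triv_eq triv_eq.
End TrivialBimodule.

Definition triv_bimod : bimod L := Bimod (triv_on 'rV[F]_1).

Lemma triv_irr : irreducible triv_bimod.
Proof.
split=> [/(congr1 (fun U : {vspace 'rV[F]_1} => \dim U)) | U _].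
  by rewrite dimvf dimv0 /dim /=.
case: (eqVneq U 0%VS) => [|nz]; [by left | right].
apply/eqP; rewrite eqEdim subvf dimvf /dim /=.
by rewrite lt0n dimv_eq0.
Qed.

Lemma trunc_tensor1 (N : bimod L) : iso_bimod N (trunc_tensor triv_bimod N).
Proof.
pose E := triv_bimod; pose e : E := (const_mx 1 : 'rV[F]_1).
have [_ Tmin] := truncT_spec E N.
have T0 : truncT E N = 0%VS.
  apply/eqP; rewrite -subv0; apply: Tmin; split=> [x t|x y m n].
    by rewrite memv0 => /eqP ->; rewrite -/(tractr _ _) !linear0 mem0v.
  rewrite /= /lact /ract /= addr0 /tens !linear0 /= !mul0mx addr0.
  exact: mem0v.
have vK t : vlift (vpi (truncT E N) t) = t.
  by have := vpiK (truncT E N) t; rewrite T0 memv0 subr_eq0 => /eqP.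
pose G : {linear tensor E N -> N} := tlift (fun (c : E) (n : N) => (c : 'rV[F]_1) 0 0 *: n).
have GE c n : G (tens c n) = (c : 'rV[F]_1) 0 0 *: n.
  apply: tlift_tens => [m a u v|m a u v] /=.
    by rewrite !mxE scalerDl scalerA.
  by rewrite scalerDr !scalerA mulrC.
have el : linear (@tens F E N e) := tens_linr e.
pose te : {linear N -> tensor E N} := HB.pack (@tens F E N e) (GRing.isLinear.Build F N _ _ _ el).
have eG t : te (G t) = t.
  apply: (tens_ext (f := te \o G) (g := idfun)) => c n /=.
  have -> : c = (c : 'rV[F]_1) 0 0 *: e by apply/rowP => i; rewrite !mxE mulr1 ord1.
  by rewrite GE tensZl tensZr !mxE mulr1.
have teact x n : te (x ▷ n) = tlact x (te n) /\ te (n ◁ x) = tract (te n) x.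
  rewrite tlact_tens tract_tens /lact /ract /=.
  by rewrite -(scale0r e) !tensZl !scale0r !add0r.
exists (linfun (vpi (truncT E N) \o te) : 'Hom(N, trunc_tensor E N)); split=> [|x n|x n].
- exists (fun w : vquot (truncT E N) => G (vlift w)) => w.
    by rewrite lfunE /= vK GE mxE scale1r.
  by rewrite lfunE; change (vpi (truncT E N) (te (G (vlift w))) = w); rewrite eG vliftK.
- rewrite !lfunE; change (vpi (truncT E N) (te (x ▷ n)) = qlact x (vpi _ (te n))).
  by rewrite qlactE (proj1 (teact x n)).
- rewrite !lfunE; change (vpi (truncT E N) (te (n ◁ x)) = qract (vpi _ (te n)) x).
  by rewrite qractE (proj2 (teact x n)).
Qed.

End TruncatedIso.

Section IsoClasses.
Local Open Scope quotient_scope.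
Variables (F : fieldType) (L : leibnizType F).

(* The finite-dimensional irreducible bimodules carried by some F^n; these
   represent all isomorphism classes, by irr_complete. Quotienting bimod itself
   would not fit in the universe of choiceType. *)
Record irr_bimod := IrrBimod {
  irr_dim : nat;
  irr_on : bimod_on L 'rV[F]_irr_dim;
  irr_valP : irreducible (Bimod irr_on)
}.
Definition irr_val (S : irr_bimod) : bimod L := Bimod (irr_on S).
Coercion irr_val : irr_bimod >-> bimod.

HB.instance Definition _ := gen_eqMixin irr_bimod.
HB.instance Definition _ := gen_choiceMixin irr_bimod.

Section StandardCarrier.
Variable M : bimod L.
Local Notation V := 'rV[F]_(dim M).
Let sl (x : L) (m : V) : V := v2r (x ▷ r2v m).
Let sr (m : V) (x : L) : V := v2r (r2v m ◁ x).
Fact std_ll m : linear (sl^~ m).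
Proof. by move=> a x y; rewrite /sl lact_linl linearP. Qed.
Fact std_lr x : linear (sl x).
Proof. by move=> a u v; rewrite /sl !linearP. Qed.
Fact std_rl x : linear (sr^~ x).
Proof. by move=> a u v; rewrite /sr linearP ract_linl linearP. Qed.
Fact std_rr m : linear (sr m).
Proof. by move=> a x y; rewrite /sr ract_linr linearP. Qed.
Fact std_LLM x y m : sl (x ∘ y) m = sl x (sl y m) - sl y (sl x m).
Proof. by rewrite /sl !v2rK bimod_LLM linearB. Qed.
Fact std_LML x y m : sr (sl x m) y = sl x (sr m y) - sr m (x ∘ y).
Proof. by rewrite /sl /sr !v2rK bimod_LML linearB. Qed.
Fact std_MLL x y m : sr (sr m x) y = sr m (x ∘ y) - sl x (sr m y).
Proof. by rewrite /sl /sr !v2rK bimod_MLL linearB. Qed.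
Definition std_on : bimod_on L V :=
  BimodOn std_ll std_lr std_rl std_rr std_LLM std_LML std_MLL.

Lemma std_iso : iso_bimod (Bimod std_on) M.
Proof.
pose f : {linear V -> M} := r2v.
exists (linfun f : 'Hom(Bimod std_on, M)); split=> [|x m|x m].
- by exists v2r => m; rewrite lfunE /= ?r2vK ?v2rK.
- by rewrite !lfunE /= v2rK.
- by rewrite !lfunE /= v2rK.
Qed.
End StandardCarrier.

Lemma irreducible_iso (M N : bimod L) : iso_bimod M N -> irreducible N -> irreducible M.
Proof.
case=> f [bf fl fr] [nz irr]; have lf : lker f == 0%VS by apply/lker0P; exact: bij_inj bf.
have fullf : (f @: fullv)%VS = fullv.
  apply/eqP; rewrite eqEsubv subvf; apply/subvP => y _; case: bf => g _ gK.
  by rewrite -(gK y) memv_img ?memvf.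
split=> [M0|U Us]; first by apply: nz; rewrite -fullf M0 limg0.
have /irr[] : subbimod (f @: U)%VS.
- by move=> x _ /memv_imgP[m /(Us x)[h1 h2] ->]; rewrite -fl -fr !memv_img.
- by move=> e; left; apply/eqP; rewrite -(eq_limg_ker0 _ _ lf) e limg0.
- by move=> e; right; apply/eqP; rewrite -(eq_limg_ker0 _ _ lf) e fullf.
Qed.

Lemma irr_complete (M : bimod L) : irreducible M -> exists S : irr_bimod, iso_bimod S M.
Proof.
move=> irrM; exists (IrrBimod (irreducible_iso (std_iso M) irrM)); exact: std_iso.
Qed.

Definition irr_iso : rel irr_bimod := fun S S' => `[< iso_bimod S S' >].

Lemma irr_iso_equiv : equiv_class_of irr_iso.
Proof.
split=> [S|S S'|S' S S'']; first by apply/asboolP; exact: iso_bimod_refl.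
  by apply/asboolP/asboolP; exact: iso_bimod_sym.
by move=> /asboolP h1 /asboolP h2; apply/asboolP; exact: iso_bimod_trans h1 h2.
Qed.
Canonical irr_iso_equivRel := EquivRelPack irr_iso_equiv.
Canonical irr_iso_encModRel := defaultEncModRel irr_iso.

Definition IrrBi := {eq_quot irr_iso}.
HB.instance Definition _ := Choice.on IrrBi.

Definition irr_class (S : irr_bimod) : IrrBi := \pi_{eq_quot irr_iso} S.
Definition irr_repr (l : IrrBi) : irr_bimod := repr (l : {eq_quot irr_iso}).

Lemma irr_reprK l : irr_class (irr_repr l) = l.
Proof. exact: reprK. Qed.

Lemma irr_classP S S' : irr_class S = irr_class S' <-> iso_bimod S S'.
Proof.
split=> [/eqP|h]; first by rewrite eqmodE => /asboolP.
by apply/eqP; rewrite eqmodE; apply/asboolP.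
Qed.

End IsoClasses.

Section CompositionSeries.
Variables (F : fieldType) (L : leibnizType F).
Implicit Types X Y : bimod L.

(* V / U ≅ S, for subbimodules U <= V of X *)
Definition factor_iso X (U V : {vspace X}) (S : bimod L) : Prop := exists f : 'Hom(X, S),
  [/\ (f @: V)%VS = fullv, (V :&: lker f)%VS = U &
      forall x m, m \in V -> f (x ▷ m) = x ▷ f m /\ f (m ◁ x) = f m ◁ x].

Definition composition_series X (k : nat) (U : nat -> {vspace X})
    (S : nat -> irr_bimod L) : Prop :=
  [/\ U 0%N = 0%VS, U k = fullv,
      forall i, (i <= k)%N -> subbimod (U i) &
      forall i, (i < k)%N -> factor_iso (U i) (U i.+1) (S i)].

Definition factor_sum (k : nat) (S : nat -> irr_bimod L) : {freeg (IrrBi L) / int} :=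
  \sum_(i < k) << irr_class (S i) >>.

(* [X] = \sum_l [X : l] l; the multiplicities do not depend on the chosen
   composition series, by the Jordan-Hölder theorem. *)
Definition bimod_class X : {freeg (IrrBi L) / int} :=
  xget 0 [set c | exists k U S, @composition_series X k U S /\ c = factor_sum k S].

Lemma composition_series_iso X Y k U S : iso_bimod X Y ->
  @composition_series X k U S -> exists U', @composition_series Y k U' S.
Proof.
case=> f [bf fl fr] [U0 Uk Us Uf].
have lf : lker f == 0%VS by apply/lker0P; exact: bij_inj bf.
have fullf : (f @: fullv)%VS = fullv.
  apply/eqP; rewrite eqEsubv subvf; apply/subvP => y _; case: bf => g _ gK.
  by rewrite -(gK y) memv_img ?memvf.
exists (fun i => f @: U i)%VS; split=> [|| i ik | i ik].
- by rewrite U0 limg0.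
- by rewrite Uk.
- move=> x _ /memv_imgP[m Um ->]; have [h1 h2] := Us i ik x m Um.
  by rewrite -fl -fr !memv_img.
have [g [gV gK ge]] := Uf i ik; exists (g \o f^-1)%VF; split.
- by rewrite -gV limg_comp -[(f^-1 @: _)%VS]limg_comp lker0_compVf // lim1g.
- apply/vspaceP => y; rewrite memv_cap memv_ker comp_lfunE /=.
  apply/andP/idP => [[/memv_imgP[m Vm ->]]|/memv_imgP[m]].
    rewrite lker0_lfunK // => gm; apply: memv_img.
    by rewrite -gK memv_cap Vm memv_ker.
  rewrite -gK memv_cap memv_ker => /andP[Vm gm] ->.
  by rewrite lker0_lfunK // memv_img.
move=> x _ /memv_imgP[m Vm ->]; rewrite -fl -fr !comp_lfunE !lker0_lfunK //.
exact: ge.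
Qed.

Lemma bimod_class_iso X Y : iso_bimod X Y -> bimod_class X = bimod_class Y.
Proof.
move=> XY; congr (xget 0 _); apply/seteqP; split=> c [k [U [S [cs ->]]]].
  by have [U' cs'] := composition_series_iso XY cs; exists k, U', S.
by have [U' cs'] := composition_series_iso (iso_bimod_sym XY) cs; exists k, U', S.
Qed.

Lemma factor_proper X (U V : {vspace X}) (S : irr_bimod L) :
  factor_iso U V S -> (U <= V)%VS /\ U <> V.
Proof.
case=> f [fV fU _]; rewrite -fU capvSl; split=> // /capv_idPl Vf.
case: (irr_valP S) => + _; apply; rewrite -fV.
by apply/eqP; rewrite -lkerE.
Qed.

Lemma bimod_class_irr (S : irr_bimod L) : bimod_class S = << irr_class S >>.
Proof.
have [nz irr] := irr_valP S.
have uniq c : (exists k U T, @composition_series S k U T /\ c = factor_sum k T) ->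
    c = << irr_class S >>.
  case=> [[|[|k]]] [U [T [[U0 Uk Us Uf] ->]]].
  - by case: nz; rewrite -Uk.
  - rewrite /factor_sum big_ord1; congr << _ >>; apply/irr_classP/iso_bimod_sym.
    have [f [fV fU fe]] := Uf 0%N isT; move: fV fU fe; rewrite Uk U0 capfv => fV fU fe.
    have lf : lker f == 0%VS by apply/eqP.
    exists f; split=> [|x m|x m]; try by case: (fe x m (memvf m)).
    exists (f^-1)%VF; first exact: lker0_lfunK.
    by move=> y; rewrite limg_lfunVK // fV memvf.
  - have [h0 n0] := factor_proper (Uf 0%N isT).
    have [h1 n1] := factor_proper (Uf 1%N isT).
    have [e|e] := irr _ (Us 1%N isT); first by case: n0; rewrite U0 e.
    by case: n1; apply/eqP; rewrite eqEsubv h1 e subvf.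
apply: uniq; rewrite /bimod_class; case: xgetP => [c _ [k [U [T h]]]|no].
  by exists k, U, T.
exfalso; apply: (no << irr_class S >>) => /=.
exists 1%N, (fun i => if i is 0 then 0%VS else fullv), (fun _ => S).
split; last by rewrite /factor_sum big_ord1.
split=> // [[|i] _ x m|[|//] _].
- by rewrite memv0 => /eqP ->; rewrite linear0 ract0 mem0v.
- by rewrite !memvf.
exists \1%VF; split; first by rewrite lim1g.
  by rewrite capfv; apply/eqP/lker0P => u v; rewrite !lfunE.
by move=> x m _; rewrite !lfunE.
Qed.

End CompositionSeries.

(* A unital commutative (not necessarily associative) ring whose additive group
   is free on a chosen basis containing the unity; bmul gives the products of
   basis elements. *)
Record based_ring := BasedRing {
  basis :> choiceType;
  bone : basis;
  bmul : basis -> basis -> {freeg basis / int};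
  bmulC : forall a b, bmul a b = bmul b a;
  bmul1 : forall a, bmul bone a = << a >>
}.

Section BasedRing.
Variable A : based_ring.
Local Notation ZA := {freeg (basis A) / int}.

Definition rone : ZA := << bone A >>.
Definition rmul (u v : ZA) : ZA := fglift (fun a => fglift (fun b => bmul a b) v) u.
End BasedRing.

Definition ring_iso (A B : based_ring) : Prop :=
  exists f : {freeg (basis A) / int} -> {freeg (basis B) / int},
    [/\ bijective f, {morph f : u v / u + v}, f (rone A) = rone B &
        {morph f : u v / rmul u v}].

Section GrothendieckRing.
Variables (F : fieldType) (L : leibnizType F).

Definition gr_one : IrrBi L := irr_class (IrrBimod (triv_irr L)).
Definition gr_mul (l l' : IrrBi L) : {freeg (IrrBi L) / int} :=
  bimod_class (trunc_tensor (irr_repr l) (irr_repr l')).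

Lemma gr_mul_class (S S' : irr_bimod L) :
  gr_mul (irr_class S) (irr_class S') = bimod_class (trunc_tensor S S').
Proof.
by apply: bimod_class_iso; apply: trunc_tensor_iso; apply/irr_classP; rewrite irr_reprK.
Qed.

Fact gr_mulC l l' : gr_mul l l' = gr_mul l' l.
Proof. exact/bimod_class_iso/trunc_tensorC. Qed.

Fact gr_mul1 l : gr_mul gr_one l = << l >>.
Proof.
rewrite -[l]irr_reprK gr_mul_class -bimod_class_irr; apply/bimod_class_iso.
exact/iso_bimod_sym/trunc_tensor1.
Qed.

Definition Gr_bi : based_ring := BasedRing gr_mulC gr_mul1.

End GrothendieckRing.

(* The integral group ring Z[G] of an abelian group G, written additively. *)
Section GroupRing.
Variable G : zmodType.
Definition gring_mul (g h : G) : {freeg G / int} := << g + h >>.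
Fact gring_mulC g h : gring_mul g h = gring_mul h g.
Proof. by rewrite /gring_mul addrC. Qed.
Fact gring_mul1 g : gring_mul 0 g = << g >>.
Proof. by rewrite /gring_mul add0r. Qed.
Definition group_ring : based_ring := BasedRing gring_mulC gring_mul1.
End GroupRing.

Section UnitalCommutativeProduct.
Variables A B : based_ring.

(* The disjoint union of A_1 \ {1}, B_1 \ {1} and {1}, where None is 1. *)
Definition circ_basis : choiceType :=
  option ({a : A | a != bone A} + {b : B | b != bone B})%type.

Definition circ_inl (a : A) : circ_basis := omap inl (insub a).
Definition circ_inr (b : B) : circ_basis := omap inr (insub b).

Definition circ_mul (c d : circ_basis) : {freeg circ_basis / int} :=
  match c, d with
  | None, _ => << d >>
  | _, None => << c >>
  | Some (inl a), Some (inl a') => fglift (fun x => << circ_inl x >>) (bmul (val a) (val a'))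
  | Some (inr b), Some (inr b') => fglift (fun x => << circ_inr x >>) (bmul (val b) (val b'))
  | _, _ => 0
  end.

Fact circ_mulC c d : circ_mul c d = circ_mul d c.
Proof. by case: c d => [[a|b]|] [[a'|b']|] //=; rewrite bmulC. Qed.
Fact circ_mul1 c : circ_mul None c = << c >>.
Proof. by []. Qed.
Definition circ : based_ring := BasedRing circ_mulC circ_mul1.

End UnitalCommutativeProduct.

Notation "A ⊛ B" := (circ A B) (at level 40, left associativity).

(* Main.v *)
(* In an irreducible bimodule the right annihilator of L is a subbimodule containing
   every x ▷ m + m ◁ x, so the right action is either 0 or the opposite of the left one.
   The left action is then irreducible; solvability makes it one-dimensional (Lie's
   theorem, proved by descending the derived series with Jacobson's lemma), given by a
   character of the abelianization of L_Lie. Hence the irreducible bimodules are two copies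
   of the character space, glued along the trivial bimodule. Truncated tensor products of
   two bimodules of the same kind add characters, and those of nontrivial bimodules of
   different kinds vanish, because a defining relation of T(M, N) is then a nonzero
   multiple of m ⊗ n. *)
Require Import Defs.
From HB Require Import structures.
From mathcomp Require Import all_boot all_order all_algebra.
From mathcomp Require Import boolp classical_sets ring freeg.

Set Implicit Arguments.
Unset Strict Implicit.
Unset Printing Implicit Defensive.

Import GRing.Theory.
Local Open Scope ring_scope.

(** * Eigenvectors and commutators of matrices over an algebraically closed field *)

Lemma linear_pred_vspace (F : fieldType) (V : vectType F) (P : V -> Prop) :
  P 0 -> (forall a u v, P u -> P v -> P (a *: u + v)) ->
  exists U : {vspace V}, forall v, P v <-> v \in U.
Proof.
move=> P0 PD.
(* A subspace contained in [P] of largest dimension is all of [P]: adding the line through a further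
   vector of [P] would enlarge it. *)
pose Q k := `[< exists U : {vspace V}, (forall v, v \in U -> P v) /\ \dim U = k >].
have exQ : exists k, Q k.
  exists 0%N; apply/asboolP; exists 0%VS; split; last by rewrite dimv0.
  by move=> v; rewrite memv0 => /eqP ->.
have ubQ k : Q k -> (k <= \dim {:V})%N.
  by move=> /asboolP[U [_ <-]]; apply/dimvS/subvf.
case: (ex_maxnP exQ ubQ) => k /asboolP[U [UP dU]] kmax; exists U => v.
split; last exact: UP.
move=> Pv; have /kmax : Q (\dim (<[v]> + U)).
  apply/asboolP; exists (<[v]> + U)%VS; split=> // _ /memv_addP[_ /vlineP[a ->] [w Uw ->]].
  by apply: PD => //; exact: UP.
rewrite -dU => le; have /eqP -> : U == (<[v]> + U)%VS by rewrite eqEdim addvSr.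
by rewrite memvE addvSl.
Qed.

Section ClosedFieldMatrices.
Variables (F : closedFieldType) (n : nat).
Implicit Types (A B C : 'M[F]_n.+1) (u v : 'rV[F]_n.+1).

(** The linear factors of the characteristic polynomial, applied in turn to a nonzero vector of [U],
    end at 0 by Cayley-Hamilton; the last nonzero vector on the way is an eigenvector. *)
Lemma stable_eigenvector A (U : {vspace 'rV[F]_n.+1}) :
  (forall v, v \in U -> v *m A \in U) -> U <> 0%VS ->
  exists a v, [/\ v \in U, v != 0 & v *m A = a *: v].
Proof.
move=> UA U0; have Uu := memv_pick U; have : vpick U != 0 by rewrite vpick0; apply/eqP.
move: (vpick U) Uu => u Uu u0.
have [s ps] := closed_field_poly_normal (char_poly A).
have : u *m horner_mx A (\prod_(z <- s) ('X - z%:P)) = 0.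
  have := Cayley_Hamilton A; rewrite ps (monicP (char_poly_monic A)) scale1r => ->.
  exact: mulmx0.
elim: s u Uu u0 {ps} => [|z s IH] u Uu u0.
  by rewrite big_nil rmorph1 mulmx1 => /eqP; rewrite (negPf u0).
rewrite big_cons rmorphM /= mulmxA rmorphB /= horner_mx_X horner_mx_C.
rewrite mulmxBr mul_mx_scalar => us0.
have [e|ne] := eqVneq (u *m A - z *: u) 0.
  by exists z, u; split=> //; apply/eqP; rewrite -subr_eq0 e.
by apply: (IH _ _ ne us0); rewrite rpredB ?rpredZ ?UA.
Qed.

(** In a nonzero stable subspace of least dimension, the eigenspaces of each matrix of [S] are
    stable by commutation, so a nonzero one is everything and every nonzero vector is a common
    eigenvector. *)
Lemma common_eigenvector (S : set 'M[F]_n.+1) :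
  (forall A B, S A -> S B -> A *m B = B *m A) ->
  exists u, u != 0 /\ forall A, S A -> exists a, u *m A = a *: u.
Proof.
move=> SC.
pose stab (U : {vspace 'rV[F]_n.+1}) :=
  U <> 0%VS /\ forall A, S A -> forall v, v \in U -> v *m A \in U.
pose Q k := `[< exists U, stab U /\ \dim U = k >].
have exQ : exists k, Q k.
  exists (\dim {:'rV[F]_n.+1}); apply/asboolP; exists fullv; split=> //.
  split=> [e|*]; last by rewrite memvf.
  have := memvf (delta_mx 0 0 : 'rV[F]_n.+1); rewrite e memv0 => /eqP/matrixP/(_ 0 0).
  by rewrite !mxE !eqxx; apply/eqP/oner_neq0.
case: (ex_minnP exQ) => k /asboolP[U [[U0 US] dU]] kmin.
exists (vpick U); split=> [|A SA]; first by rewrite vpick0; apply/eqP.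
have [a [w [Uw w0 wA]]] := stable_eigenvector (US A SA) U0; exists a.
have [W WP] : exists W : {vspace 'rV[F]_n.+1},
    forall v, v \in U /\ v *m A = a *: v <-> v \in W.
  apply: linear_pred_vspace => [|b u v [Uu uA] [Uv vA]].
    by rewrite mem0v mul0mx scaler0.
  by rewrite rpredD ?rpredZ // mulmxDl -scalemxAl uA vA scalerDr !scalerA mulrC.
have sWU : (W <= U)%VS by apply/subvP => v /(proj2 (WP v))[].
have /kmin : Q (\dim W).
  apply/asboolP; exists W; split=> //; split=> [e|B SB v /(proj2 (WP v))[Uv vA]].
    by have /(proj1 (WP w)) : w \in U /\ w *m A = a *: w by []; rewrite e memv0 (negPf w0).
  by apply: (proj1 (WP _)); rewrite US // -mulmxA (SC B A) // mulmxA vA -scalemxAl.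
rewrite -dU => le; have /eqP e : W == U by rewrite eqEdim sWU.
by have /(proj2 (WP _))[] : vpick U \in W by rewrite e memv_pick.
Qed.

(* [-, A] acts on polynomials in B as the derivation sending B to C. *)
Lemma commutator_horner A B C (p : {poly F}) :
  B *m A - A *m B = C -> C *m B = B *m C ->
  horner_mx B p *m A - A *m horner_mx B p = horner_mx B p^`() *m C.
Proof.
move=> defC CB; elim/poly_ind: p => [|p c IH].
  by rewrite deriv0 !rmorph0 !mul0mx mulmx0 subr0.
rewrite derivMXaddC !rmorphD !rmorphM /= horner_mx_X horner_mx_C -!mulmxE.
move: (horner_mx B p) (horner_mx B p^`()) IH => P P' /(canRL (subrK _)) IH.
rewrite !mulmxDl !mulmxDr scalar_mxC opprD addrACA subrr addr0.
rewrite -mulmxA -(subrK (A *m B) (B *m A)) defC mulmxDr mulmxA IH mulmxDl mulmxA.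
by rewrite addrA addrK -!mulmxA CB !mulmxA.
Qed.

Hypothesis charF0 : [pchar F] =i pred0.

Lemma size_deriv_pchar0 (p : {poly F}) d : size p = d.+2 -> size p^`() = d.+1.
Proof.
move=> sp; apply/eqP; rewrite eqn_leq; apply/andP; split.
  by have := lt_size_deriv (p := p); rewrite -size_poly_gt0 sp; apply.
rewrite ltnNge; apply: contraTN isT => /leq_sizeP/(_ d (leqnn d))/eqP.
rewrite coef_deriv -mulr_natr mulf_eq0 (proj1 (pcharf0P _) charF0) orbF.
by rewrite -[d.+1]/(d.+2.-1) -sp -lead_coefE lead_coef_eq0 -size_poly_eq0 sp.
Qed.

(* Jacobson's lemma: if p(B) C^m = 0, bracketing with A gives p'(B) C^(2m+1) = 0. *)
Lemma commutator_nilpotent A B C :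
  B *m A - A *m B = C -> C *m B = B *m C -> exists k, C ^+ k = 0.
Proof.
move=> defC CB.
(* Starting from the characteristic polynomial with [m = 0], repeated differentiation ends at a
   nonzero constant, which leaves a power of [C] equal to 0. *)
have nil d (p : {poly F}) m : size p = d.+1 -> horner_mx B p *m C ^+ m = 0 ->
    exists k, C ^+ k = 0.
  elim: d p m => [|d IH] p m sp pC.
    have /size_poly1P[c c0 pc] : size p == 1%N by rewrite sp.
    exists m; move: pC; rewrite pc horner_mx_C mul_scalar_mx => /eqP.
    by rewrite scaler_eq0 (negPf c0) => /eqP.
  have qC : comm_mx (horner_mx B p^`()) C by apply: comm_horner_mx; exact/esym.
  have PC : comm_mx (horner_mx B p) (C ^+ m).
    by apply: comm_horner_mx; exact/commrX/esym.
  apply: (IH p^`() (m + (m.+1)) (size_deriv_pchar0 sp)).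
  have -> : C ^+ (m + m.+1) = C ^+ m *m (C *m C ^+ m) by rewrite exprD exprS.
  have qCm : comm_mx (horner_mx B p^`()) (C ^+ m) := commrX m qC.
  (* The product p'(B) C is the commutator of p(B) and [A]; between two factors [C ^+ m], each of
     its terms contains p(B) C^m. *)
  rewrite (mulmxA _ (C ^+ m)) qCm -mulmxA (mulmxA _ C) -(commutator_horner p defC CB).
  by rewrite mulmxBl mulmxBr -!mulmxA pC !mulmx0 subr0 mulmxA -PC pC mul0mx.
by apply: (nil _ _ 0%N (size_char_poly B)); rewrite Cayley_Hamilton mul0mx.
Qed.

End ClosedFieldMatrices.

(** * The derived series and Lie's theorem *)

Section DerivedIdeals.
Variables (F : fieldType) (L : leibnizType F).

(** Left multiplications are derivations, so the ideal property passes to the span of products. *)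
Lemma derived_ideall k (x y : L) : derived k x -> derived k (y ∘ x).
Proof.
elim: k x y => [//|k IH] x y; move: x; apply: lspan_min => [|a u v|_ [u [v [du dv ->]]]].
- by rewrite lbr0r; exact: lspan0.
- by rewrite lbrDr lbrZr => *; apply/lspanD => //; exact: lspanZ.
rewrite lbr_leibniz; apply: lspanD; apply: lspan_incl.
  by exists (y ∘ u), v; split=> //; exact: IH.
by exists u, (y ∘ v); split=> //; exact: IH.
Qed.

Lemma derived1_mul (x y : L) : derived 1 (x ∘ y).
Proof. by apply: lspan_incl; exists x, y. Qed.

End DerivedIdeals.

(* Matrices act on row vectors from the right, so [rho] reverses the order of composition. *)
Section Lie.
Variables (F : closedFieldType) (L : leibnizType F) (n : nat).
Variable rho : L -> 'M[F]_n.+1.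
Hypothesis charF0 : [pchar F] =i pred0.
Hypothesis rho_lin : linear rho.
Hypothesis rho_mul : forall x y, rho (x ∘ y) = rho y *m rho x - rho x *m rho y.
Hypothesis rho_irr : forall U : {vspace 'rV[F]_n.+1},
  (forall x v, v \in U -> v *m rho x \in U) -> U = 0%VS \/ U = fullv.

(** Lets irreducibility be applied to a property of vectors without constructing its subspace each
    time. *)
Lemma irr_pred (P : 'rV[F]_n.+1 -> Prop) (v0 : 'rV[F]_n.+1) :
  P 0 -> (forall a u v, P u -> P v -> P (a *: u + v)) ->
  (forall x v, P v -> P (v *m rho x)) -> v0 != 0 -> P v0 -> forall v, P v.
Proof.
move=> P0 PD Pst v0n0 Pv0 v; have [U UP] := linear_pred_vspace P0 PD.
have /rho_irr[e|e] : forall x v, v \in U -> v *m rho x \in U.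
- by move=> x w /UP Pw; apply/UP/Pst.
- by move/UP: Pv0; rewrite e memv0 (negPf v0n0).
- by apply/UP; rewrite e memvf.
Qed.

(** [A] has an eigenvector, and its eigenspace is stable under every [rho x]. *)
Lemma schur_scalar A : (forall x, A *m rho x = rho x *m A) -> exists a, A = a%:M.
Proof.
move=> AC; have [//|u [u0 uA]] := @common_eigenvector F n [set A] _.
  by move=> B C -> ->.
have [a ua] := uA A erefl; exists a; apply/row_matrixP => i.
rewrite !rowE mul_mx_scalar; apply: (irr_pred (P := fun v => v *m A = a *: v) _ _ _ u0 ua).
- by rewrite mul0mx scaler0.
- by move=> b v w vA wA; rewrite mulmxDl -scalemxAl vA wA scalerDr !scalerA mulrC.
- by move=> x v vA; rewrite -mulmxA -AC mulmxA vA scalemxAl.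
Qed.

(* If L^(k+2) acts by 0 then L^(k+1) acts by commuting operators. A common eigenvector of
   these is killed by every rho (y ∘ x) with x in L^(k+1), which is nilpotent; the vectors
   with this property form a subrepresentation, so L^(k+1) acts by central operators, hence
   by scalars, of trace 0 because L^(k+1) is spanned by products. *)
Lemma solvable_irr_derived : solvable_leibniz L -> forall x : L, derived 1 x -> rho x = 0.
Proof.
have rho0 : rho 0 = 0.
  by have := rho_lin (-1) 0 0; rewrite scaler0 addr0 scaleN1r addNr.
have rhoN x y : rho (x ∘ y) = 0 -> rho y *m rho x = rho x *m rho y.
  by rewrite rho_mul => /eqP; rewrite subr_eq0 => /eqP.
case=> k solk.
(* The shift by one makes the descent stop at [derived 1] instead of the whole algebra. *)
have {solk}: forall x : L, derived k.+1 x -> rho x = 0.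
  move=> x; have sub : forall x : L, derived k.+1 x -> x = 0.
    apply: lspan_min => [//|a u v -> ->|_ [u [v [/solk-> _ ->]]]].
      by rewrite scaler0 addr0.
    by rewrite lbr0l.
  by move/sub ->.
elim: k => [//|k IH] Ik2; apply: IH.
have comm (x y : L) : derived k.+1 x -> derived k.+1 y -> rho x *m rho y = rho y *m rho x.
  move=> dx dy; apply: rhoN; apply: Ik2; apply: lspan_incl; by exists y, x.
have [|u [u0 uE]] := @common_eigenvector F n (rho @` derived k.+1)%classic.
  by move=> _ _ [x dx <-] [y dy <-]; exact: comm.
have J0 : forall x y : L, derived k.+1 x -> rho (y ∘ x) = 0.
  pose P (v : 'rV[F]_n.+1) := forall x y : L, derived k.+1 x -> v *m rho (y ∘ x) = 0.
  have Pu : P u.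
    move=> x y dx; have dyx := derived_ideall y dx.
    (* Here [B] is [rho x], [A] is [rho y] and [C] is [rho (y ∘ x)]; [B] and [C] commute since [x]
       and [y ∘ x] both lie in [derived k.+1]. The eigenvalue of the nilpotent [C] at [u] is then
       0. *)
    have [|m cm] := commutator_nilpotent charF0 (esym (rho_mul y x)).
      exact: comm.
    have [a ua] := uE _ (ex_intro2 _ _ _ dyx erefl); rewrite ua.
    have uX j : u *m rho (y ∘ x) ^+ j = a ^+ j *: u.
      elim: j => [|j IHj]; first by rewrite !expr0 mulmx1 scale1r.
      by rewrite !exprS -mulmxE mulmxA ua -scalemxAl IHj scalerA.
    move: (uX m); rewrite cm mulmx0 => /esym/eqP; rewrite scaler_eq0 (negPf u0) orbF.
    by rewrite expf_eq0 => /andP[_ /eqP ->]; rewrite scale0r.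
  have Pall : forall v, P v.
    apply: (irr_pred _ _ _ u0 Pu) => [z y _|b v w Pv Pw z y dz|z v Pv t y dt].
    - by rewrite mul0mx.
    - by rewrite mulmxDl -scalemxAl Pv // Pw // scaler0 addr0.
    (* As [y ∘ t] is again in [derived k.+1], [v] is killed by [rho (z ∘ (y ∘ t))] and by
       [rho (y ∘ t)]; hence [rho (y ∘ t)] kills [v *m rho z]. *)
    have := congr1 (mulmx v) (rho_mul z (y ∘ t)).
    rewrite mulmxBr !mulmxA (Pv t y) // mul0mx sub0r (Pv (y ∘ t)) => [/esym/eqP|].
      by rewrite oppr_eq0 => /eqP.
    exact: derived_ideall.
  by move=> x y dx; apply/row_matrixP => i; rewrite row0 rowE Pall.
move=> x dx; have [a ra] : exists a, rho x = a%:M.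
  by apply: schur_scalar => y; apply/rhoN/J0.
suff : \tr (rho x) = 0.
  rewrite ra mxtrace_scalar -mulr_natr => /eqP; rewrite mulf_eq0.
  by rewrite (proj1 (pcharf0P _) charF0) orbF => /eqP ->; rewrite raddf0.
move: x dx {a ra}; apply: lspan_min => [|a u' v hu hv|_ [x [y [_ _ ->]]]].
- by rewrite rho0 mxtrace0.
- by rewrite rho_lin mxtraceD mxtraceZ hu hv mulr0 addr0.
by rewrite rho_mul linearB /= mxtrace_mulC subrr.
Qed.

(** The operators commute, hence are scalars by Schur's lemma; every line is stable, so the space of
    dimension [n.+1] is a line. *)
Lemma lie_theorem : solvable_leibniz L ->
  n = 0%N /\ forall x y, rho (x ∘ y) = 0.
Proof.
move=> sol; have d1 := solvable_irr_derived sol.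
have r0 x y : rho (x ∘ y) = 0 by exact/d1/derived1_mul.
split=> //; pose u : 'rV[F]_n.+1 := delta_mx 0 0.
have u0 : u != 0.
  by apply/eqP/matrixP => /(_ 0 0); rewrite !mxE !eqxx; apply/eqP/oner_neq0.
have [|e|] := rho_irr (U := <[u]>%VS).
- move=> x _ /vlineP[b ->]; have [a ->] : exists a, rho x = a%:M.
    by apply: schur_scalar => y; apply/eqP; rewrite -subr_eq0 -rho_mul r0.
  by rewrite mul_mx_scalar memvZ // memvZ ?memv_line.
- by move: (memv_line u); rewrite e memv0 (negPf u0).
by move/(congr1 (fun U => \dim U)); rewrite dim_vline u0 dimvf /dim /= mul1n => -[].
Qed.

End Lie.

(** * One-dimensional bimodules and their truncated tensor products *)

Lemma scaler_injr (F : fieldType) (V : lmodType F) (v : V) :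
  v != 0 -> injective (fun a : F => a *: v).
Proof.
by move=> v0 a b /eqP; rewrite -subr_eq0 -scalerBl scaler_eq0 (negPf v0) orbF subr_eq0 => /eqP.
Qed.

Section WeightBimodules.
Variables (F : fieldType) (L : leibnizType F).
Implicit Types (chi psi : L -> F) (b : bool) (M N : bimod L).

Definition is_character chi := scalar chi /\ forall x y, chi (x ∘ y) = 0.

(* [b] selects the symmetric ([m ◁ x = - (x ▷ m)]) or antisymmetric ([m ◁ x = 0]) bimodule. *)
Definition weight_action M chi b :=
  (forall x m, x ▷ m = chi x *: m :> M) /\
  (forall x m, m ◁ x = (- b%:R * chi x) *: m :> M).

Section OneDimensional.
Variables (chi : L -> F) (b : bool) (chi_char : is_character chi).

Let la (x : L) (m : 'rV[F]_1) : 'rV[F]_1 := chi x *: m.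
Let ra (m : 'rV[F]_1) (x : L) : 'rV[F]_1 := (- b%:R * chi x) *: m.

Fact weight_ll m : linear (la^~ m).
Proof. by move=> a x y; rewrite /la chi_char.1 scalerDl scalerA. Qed.
Fact weight_lr x : linear (la x).
Proof. by move=> a u v; rewrite /la scalerDr !scalerA mulrC. Qed.
Fact weight_rl x : linear (ra^~ x).
Proof. by move=> a u v; rewrite /ra scalerDr !scalerA mulrC. Qed.
Fact weight_rr m : linear (ra m).
Proof. by move=> a x y; rewrite /ra chi_char.1 mulrDr scalerDl scalerA mulrCA. Qed.
Fact weight_LLM x y m : la (x ∘ y) m = la x (la y m) - la y (la x m).
Proof. by rewrite /la chi_char.2 !scalerA mulrC subrr scale0r. Qed.
Fact weight_LML x y m : ra (la x m) y = la x (ra m y) - ra m (x ∘ y).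
Proof. by rewrite /la /ra chi_char.2 mulr0 scale0r subr0 !scalerA mulrC. Qed.
Fact weight_MLL x y m : ra (ra m x) y = ra m (x ∘ y) - la x (ra m y).
Proof.
rewrite /la /ra chi_char.2 mulr0 scale0r sub0r !scalerA -scaleNr; congr (_ *: _).
by case: b; rewrite /= ?mulr1n ?mulr0n ?oppr0 ?mul0r ?mulr0 ?oppr0 //; ring.
Qed.

Definition weight_on : bimod_on L 'rV[F]_1 :=
  BimodOn weight_ll weight_lr weight_rl weight_rr weight_LLM weight_LML weight_MLL.

Lemma weight_irreducible : irreducible (Bimod weight_on).
Proof.
split=> [/(congr1 (fun U : {vspace 'rV[F]_1} => \dim U))|U _].
  by rewrite dimvf dimv0 /dim /=.
case: (eqVneq U 0%VS) => [|nz]; [by left | right].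
by apply/eqP; rewrite eqEdim subvf dimvf /dim /= lt0n dimv_eq0.
Qed.

Definition weight_bimod : irr_bimod L := IrrBimod weight_irreducible.

Lemma weight_bimodP : weight_action weight_bimod chi b.
Proof. by []. Qed.

Lemma weight_bimod_iso M : dim M = 1%N -> weight_action M chi b ->
  iso_bimod M weight_bimod.
Proof.
move=> dM [Ml Mr]; apply: iso_bimod_sym; pose e : M := vpick fullv.
have e0 : e != 0 by rewrite vpick0 -dimv_eq0 dimvf dM.
have glin : linear (fun r : 'rV[F]_1 => r 0 0 *: e).
  by move=> a u v; rewrite !mxE scalerDl scalerA.
pose g : {linear 'rV[F]_1 -> M} := HB.pack (fun r : 'rV[F]_1 => r 0 0 *: e)
  (GRing.isLinear.Build F 'rV[F]_1 M _ (fun r : 'rV[F]_1 => r 0 0 *: e) glin).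
pose f : 'Hom(weight_bimod, M) := linfun g.
have fE r : f r = (r : 'rV[F]_1) 0 0 *: e by rewrite lfunE.
have lf : lker f == 0%VS.
  apply/lker0P => r s; rewrite !fE => /(scaler_injr e0) rs.
  by apply/rowP => i; rewrite !ord1.
have ff : (f @: fullv)%VS = fullv.
  apply/eqP; rewrite eqEdim subvf limg_dim_eq ?(eqP lf) ?capv0 //.
  by rewrite !dimvf dM.
exists f; split=> [|x r|x r].
- exists (f^-1)%VF; first exact: lker0_lfunK.
  by move=> m; rewrite limg_lfunVK // ff memvf.
- by rewrite Ml (proj1 weight_bimodP) linearZ.
- by rewrite Mr (proj2 weight_bimodP) linearZ.
Qed.

End OneDimensional.

(** The scalars are compared on the nonzero image of a vector. The right actions distinguish [b]
    from [c] only for a nonzero character, hence the form of the second equality. *)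
Lemma weight_bimod_inj chi psi b c (hchi : is_character chi) (hpsi : is_character psi) :
  iso_bimod (weight_bimod b hchi) (weight_bimod c hpsi) ->
  chi =1 psi /\ forall x, b%:R * chi x = c%:R * psi x.
Proof.
case=> f [bf fl fr]; pose e : weight_bimod b hchi := (const_mx 1 : 'rV[F]_1).
have fe0 : f e != 0.
  rewrite -(linear0 f) (inj_eq (bij_inj bf)); apply/eqP => /rowP/(_ 0).
  by rewrite !mxE; apply/eqP/oner_neq0.
split=> x; apply: (scaler_injr fe0).
  by rewrite -linearZ; have := fl x e; rewrite !(proj1 (weight_bimodP _ _)).
apply: oppr_inj; rewrite -!scaleNr -!mulNr -linearZ.
by have := fr x e; rewrite !(proj2 (weight_bimodP _ _)).
Qed.

Lemma irreducible_sym_or_anti M : irreducible M ->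
  exists b, forall x (m : M), m ◁ x = - b%:R *: (x ▷ m).
Proof.
move=> [_ irr]; have [U UP] : exists U : {vspace M}, forall m : M,
    (forall y, m ◁ y = 0) <-> m \in U.
  apply: linear_pred_vspace => [y|a u v hu hv y]; first exact: ract0.
  by rewrite ract_linl hu hv scaler0 addr0.
have [x m /UP mU|U0|Ufull] := irr U.
- split; apply/UP => y; last by rewrite mU ract0.
  by rewrite bimod_LML !mU linear0 subr0.
(* The axioms (LML) and (MLL) add up to 0, so [x ▷ m + m ◁ x] is in the right annihilator [U], which
   is 0 here. *)
- exists true => x m; apply/eqP; rewrite scaleN1r -addr_eq0 addrC -memv0 -U0.
  by apply/UP => y; rewrite ractD bimod_LML bimod_MLL addrC subrKA subrr.
- by exists false => x m; rewrite oppr0 scale0r; move: x; apply/UP; rewrite Ufull memvf.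
Qed.

Section WeightTensor.
Variables (M N : bimod L) (chi psi : L -> F) (b c : bool).
Hypotheses (dM : dim M = 1%N) (dN : dim N = 1%N).
Hypotheses (Mw : weight_action M chi b) (Nw : weight_action N psi c).

Let dT : dim (tensor M N) = 1%N.
Proof. by rewrite /dim /= dM dN. Qed.

(** For equal kinds every generator of T(M, N) has the factor b(1 - b) = 0, so nothing is divided
    out of the line [tensor M N]. *)
Lemma weight_tensor_same : b = c ->
  weight_action (trunc_tensor M N) (fun x => chi x + psi x) b /\ dim (trunc_tensor M N) = 1%N.
Proof.
case: Mw Nw => Ml Mr [Nl Nr] bc; have [_ Tmin] := truncT_spec M N.
have lE x t : tlact x t = (chi x + psi x) *: t :> tensor M N.
  apply: (tens_ext (f := @tlact _ _ M N x) (g := (chi x + psi x) \*: idfun)) => u v /=.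
  by rewrite tlact_tens Ml Nl tensZl tensZr scalerDl.
have rE x t : tract t x = (- b%:R * (chi x + psi x)) *: t :> tensor M N.
  apply: (tens_ext (f := tractr x) (g := (- b%:R * (chi x + psi x)) \*: idfun)) => u v /=.
  by rewrite /tractr tract_tens Mr Nr -bc tensZl tensZr mulrDr scalerDl.
have T0 : truncT M N = 0%VS.
  apply/eqP; rewrite -subv0; apply: Tmin; split=> [x t|x y m n].
    by rewrite lE rE => ?; rewrite !rpredZ.
  rewrite Ml Nl !Mr !Nr -!scalerDl !tensZl !tensZr -bc !scalerA -scalerDl.
  rewrite [X in X *: _](_ : _ = 0) ?scale0r ?mem0v //.
  by case: b; rewrite /= ?mulr1n ?mulr0n ?oppr0; ring.
split; last first.
  by rewrite /dim /= dimv_compl T0 dimv0 subn0 dimvf dT.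
split=> x w; first by rewrite /lact /= /qlact lE linearZ /= vliftK.
by rewrite /ract /= /qract rE linearZ /= vliftK.
Qed.

Lemma weight_tensor_mixed : b -> ~~ c -> (exists x, chi x != 0) -> (exists x, psi x != 0) ->
  (fullv : {vspace trunc_tensor M N}) = 0%VS.
Proof.
move=> bT cF [y chiy] [x psix]; case: Mw Nw => Ml Mr [Nl Nr].
have [[_ gT] _] := truncT_spec M N.
have q0 : vpi (truncT M N) =1 \0.
  apply: (tens_ext (f := vpi (truncT M N)) (g := \0)) => u v /=.
  apply/eqP; rewrite vpi_eq0; have := gT x y u v.
  (* The first summand of the generator vanishes; the second is -chi(y) psi(x) times [tens u v]. *)
  rewrite Ml Nl !Mr !Nr bT (negPf cF) oppr0 !mul0r !scale0r mulN1r scaleNr subrr addr0.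
  have -> w : tens (0 : M) w = 0 :> tensor M N by rewrite -(scale0r 0) tensZl scale0r.
  rewrite add0r mulN1r tensZl tensZr scalerA rpredZeq mulf_eq0 oppr_eq0.
  by rewrite (negPf chiy) (negPf psix).
apply/eqP; rewrite -subv0; apply/subvP => w _.
by rewrite memv0 -[w](vliftK (w : vquot (truncT M N))) q0.
Qed.

End WeightTensor.

(** Each step of a composition series is a proper inclusion, so only the empty series is possible;
    the default of [xget] is also 0. *)
Lemma bimod_class0 M : (fullv : {vspace M}) = 0%VS -> bimod_class M = 0.
Proof.
move=> M0; rewrite /bimod_class; case: xgetP => [c _ [k [U [S [[U0 Uk Us Uf] ->]]]]|//].
case: k Uk Us Uf => [|k] Uk Us Uf; first by rewrite /factor_sum big_ord0.
have [_ []] := factor_proper (Uf k (leqnn _)).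
have z (V : {vspace M}) : V = 0%VS by apply/eqP; rewrite -subv0 -M0 subvf.
by rewrite [U k]z [U _]z.
Qed.

End WeightBimodules.

(** * Classification of the irreducible bimodules *)

Section Classification.
Variables (F : closedFieldType) (L : leibnizType F).
Hypotheses (charF0 : [pchar F] =i pred0) (solL : solvable_leibniz L).

Lemma irr_bimod_weight (S : irr_bimod L) :
  exists chi b (hchi : is_character chi), iso_bimod S (weight_bimod b hchi).
Proof.
have [b rS] := irreducible_sym_or_anti (irr_valP S).
case: S rS => [[|d] act irr] rS /=.
  have [+ _] := irr; case; apply/eqP; rewrite -dimv_eq0 dimvf /dim /=.
  by rewrite muln0.
pose la x : {linear 'rV[F]_d.+1 -> 'rV[F]_d.+1} := HB.pack (lact_on act x)
  (GRing.isLinear.Build F 'rV[F]_d.+1 'rV[F]_d.+1 _ (lact_on act x) (lact_on_linr act x)).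
pose rho x : 'M[F]_d.+1 := lin1_mx (la x).
have rhoE x (v : 'rV[F]_d.+1) : v *m rho x = @lact F L (Bimod act) x v.
  exact: mul_rV_lin1 (la x) v.
have [|x y|U Us|d0 rho0] := @lie_theorem F L d rho charF0 _ _ _ solL.
- by move=> a x y; apply/row_matrixP => i; rewrite !rowE mulmxDr -scalemxAr !rhoE lact_linl.
- by apply/row_matrixP => i; rewrite !rowE mulmxBr !mulmxA !rhoE bimod_LLM.
(* The right action is a multiple of the left one, so left-stable subspaces are subbimodules. *)
- apply: (proj2 irr) => x m Um; split; first by rewrite -rhoE Us.
  by rewrite rS rpredZ // -rhoE Us.
move: d0 => e; subst d; pose chi x := rho x 0 0.
have actE x (v : 'rV[F]_1) : @lact F L (Bimod act) x v = chi x *: v.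
  by rewrite -rhoE [rho x]mx11_scalar mul_mx_scalar.
have hchi : is_character chi.
  split=> [a x y|x y]; last by rewrite /chi rho0 mxE.
  have := congr1 (fun v : 'rV_1 => v 0 0) (lact_linl (M := Bimod act) (const_mx 1) a x y).
  by rewrite /= !actE !mxE !mulr1.
exists chi, b, hchi; apply: weight_bimod_iso; first by rewrite /dim /=.
by split=> [|x m]; [exact: actE | rewrite /= rS actE scalerA].
Qed.

End Classification.

(** * Dimension of quotients and the space of characters *)

Section Dimension.
Variable F : fieldType.

Lemma findim_surj (V W : lmodType F) (f : V -> W) :
  linear f -> (forall w, exists v, f v = w) -> findim V -> findim W.
Proof.
move=> flin fsurj [m0 [b0 b0P]].
pose spans m := `[< exists b : 'I_m -> W,
  forall w, exists c : 'rV[F]_m, w = \sum_i c 0 i *: b i >].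
have exS : exists m, spans m.
  exists m0; apply/asboolP; exists (f \o b0) => w; have [v <-] := fsurj w.
  by have [c [vc _]] := b0P v; exists c; rewrite {1}vc (linear_fsum _ _ flin).
case: (ex_minnP exS) => m /asboolP[b bS] bmin; exists m, b => w.
have [c wc] := bS w; exists c; split=> // c' wc'; apply/eqP; rewrite -subr_eq0.
apply: contraTT isT => /matrix0Pn[i0 [i]]; rewrite {i0}ord1 => di0.
have d0 : \sum_i (c - c') 0 i *: b i = 0.
  apply/eqP; rewrite -[X in _ == X](subrr w) {1}wc wc' -sumrB; apply/eqP.
  by apply: eq_bigr => j _; rewrite !mxE scalerBl.
move: (c - c') d0 di0 => {c c' wc wc'} d.
case: m i b bS bmin d => [[]//|m] i b bS bmin d + di0.
rewrite (bigD1_ord i) //= => /eqP; rewrite addr_eq0 => /eqP dbi.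
have : spans m; last by move/bmin; rewrite ltnn.
apply/asboolP; exists (b \o fintype.lift i) => w'; have [c ->] := bS w'.
(* These coefficients come from eliminating [b i] by means of [d]. *)
exists (\row_j (c 0 (fintype.lift i j) - c 0 i / d 0 i * d 0 (fintype.lift i j))).
have bi : b i = - (d 0 i)^-1 *: \sum_j d 0 (fintype.lift i j) *: b (fintype.lift i j).
  by rewrite scaleNr -scalerN -dbi scalerA mulVf // scale1r.
rewrite (bigD1_ord i) //= {1}bi scalerA scaler_sumr -big_split /=.
apply: eq_bigr => j _; rewrite mxE scalerBl addrC scalerA; congr (_ + _).
by rewrite -scaleNr; congr (_ *: _); ring.
Qed.

Lemma has_dim_ldim (V : lmodType F) : findim V -> has_dim V (ldim V).
Proof. exact: xgetPex. Qed.

End Dimension.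

Section CharacterSpace.
Variables (F : fieldType) (L : leibnizType F).
Local Notation lie := (canonical_lie L).
Local Notation n := (ldim (abelianization lie)).

Let ab (x : L) : abelianization lie := lpi _ (lpi _ x).

Let ab_linear : linear ab.
Proof. by move=> a x y; rewrite /ab !lpi_linear. Qed.

Lemma character_linearP (chi : L -> F) a x y : is_character chi ->
  chi (a *: x + y) = a * chi x + chi y.
Proof. by case=> + _; apply. Qed.

Lemma character0 (chi : L -> F) : is_character chi -> chi 0 = 0.
Proof.
by move=> hchi; rewrite -[0](addr0 0) -{1}(scaler0 _ (-1)) character_linearP // mulN1r addNr.
Qed.

(** A character kills squares, hence factors through L_Lie; it kills products, hence factors further
    through the abelianization. *)
Lemma character_ab0 (chi : L -> F) x : is_character chi -> ab x = 0 -> chi x = 0.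
Proof.
move=> hchi; have chi0 := character0 hchi.
have chiL y : lpi (@squares F L) y = 0 -> chi y = 0.
  rewrite -[0](subrr (lpi _ 0)) -lpiB subr0 => /lpi_eq; rewrite subr0.
  move: y; apply: lspan_min => [//|a u v hu hv|_ [u ->]]; last exact: hchi.2.
  by rewrite character_linearP // hu hv mulr0 addr0.
rewrite -[0](subrr (lpi _ 0)) -lpiB subr0 => /lpi_eq; rewrite subr0.
(* The span lives in [lie], so the claim is made for all preimages in [L] at once. *)
pose P (q : lie) := forall y, lpi _ y = q -> chi y = 0.
suff : forall q, lspan (products [set: lie] [set: lie]) q -> P q by move=> h /h; apply.
apply: lspan_min => [y|a p q hp hq y yE|_ [p [q [_ _ ->]]] y yE]; first exact: chiL.
  have [[u up] [v vq]] := (lpi_surj p, lpi_surj q).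
  have -> : y = 1 *: (y - (a *: u + v)) + (a *: u + v) by rewrite scale1r subrK.
  rewrite !character_linearP // (hp u) // (hq v) // mulr0 !addr0 mul1r.
  by apply: chiL; rewrite lpiB lpi_linear yE up vq subrr.
have [[u up] [v vq]] := (lpi_surj p, lpi_surj q).
have -> : y = 1 *: (y - u ∘ v) + u ∘ v by rewrite scale1r subrK.
rewrite character_linearP // hchi.2 addr0 mul1r; apply: chiL.
by rewrite lpiB yE -up -vq [lbr _ _]lie_brE subrr.
Qed.

(** Characters are the linear forms on the abelianization; a basis of it identifies them with row
    vectors of coordinates. *)
Lemma character_space : findim lie -> exists X : 'rV[F]_n -> L -> F,
  [/\ forall v, is_character (X v),
      forall v w x, X (v + w) x = X v x + X w x,
      forall v w, X v =1 X w -> v = w &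
      forall chi, is_character chi -> exists v, X v =1 chi].
Proof.
move=> fin; have fina : findim (abelianization lie).
  exact: (findim_surj (@lpi_linear _ _ _) (@lpi_surj _ _ _) fin).
have [b bP] := has_dim_ldim fina.
have /choice[co coE] w : exists c : 'rV[F]_n, w = \sum_i c 0 i *: b i.
  by have [c [wc _]] := bP w; exists c.
have coU w (c : 'rV[F]_n) : w = \sum_i c 0 i *: b i -> co w = c.
  by move=> wc; have [d [_ dU]] := bP w; rewrite -(dU _ wc) -(dU _ (coE w)).
have co_lin a w w' : co (a *: w + w') = a *: co w + co w'.
  apply: coU; rewrite {1}(coE w) {1}(coE w') scaler_sumr -big_split /=.
  by apply: eq_bigr => i _; rewrite !mxE scalerDl scalerA.
have co_b i : co (b i) = delta_mx 0 i.
  apply: coU; rewrite (bigD1 i) //= big1 => [|j ji]; first by rewrite mxE !eqxx scale1r addr0.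
  by rewrite mxE (negPf ji) andbF scale0r.
have /choice[y yE] i : exists x, ab x = b i.
  have [q qE] := lpi_surj (b i); have [x xE] := lpi_surj q.
  by exists x; rewrite /ab xE.
pose X (v : 'rV[F]_n) x := \sum_i co (ab x) 0 i * v 0 i.
have X_y v i : X v (y i) = v 0 i.
  rewrite /X yE co_b (bigD1 i) //= big1 => [|j ji]; first by rewrite mxE !eqxx mul1r addr0.
  by rewrite mxE (negPf ji) andbF mul0r.
have X_char v : is_character (X v).
  split=> [a x z|x z]; rewrite /X.
    rewrite ab_linear co_lin mulr_sumr -big_split /=.
    by apply: eq_bigr => i _; rewrite !mxE mulrDl mulrA.
  have -> : ab (x ∘ z) = 0.
    rewrite -[0](subrr (lpi _ 0)) -lpiB subr0; apply/lpi_eq; rewrite subr0.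
    by rewrite -lie_brE; apply: lspan_incl; exists (lpi _ x), (lpi _ z).
  have -> : co 0 = 0 by have := co_lin (-1) 0 0; rewrite scaler0 addr0 scaleN1r addNr.
  by apply: big1 => i _; rewrite mxE mul0r.
exists X; split=> [//|v w x|v w vw|chi hchi].
- by rewrite -big_split; apply: eq_bigr => i _; rewrite mxE mulrDr.
- by apply/rowP => i; rewrite -!X_y.
(* The coordinates of [chi] are its values at the lifts [y i] of the basis; [z] has the same image
   as [x] in the abelianization, so [chi] agrees on both. *)
exists (\row_i chi (y i)) => x; pose z := \sum_i co (ab x) 0 i *: y i.
have -> : chi x = chi (1 *: (x - z) + z) by rewrite scale1r subrK.
rewrite character_linearP // (character_ab0 hchi) => [|]; last first.
  have zx : ab z = ab x.
    by rewrite (linear_fsum _ _ ab_linear) [RHS]coE; apply: eq_bigr => i _; rewrite yE.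
  by rewrite -[x - z]addrC -scaleN1r ab_linear zx scaleN1r addNr.
rewrite mulr0 add0r (linear_fsum (W := F^o) _ _ hchi.1) /X.
by apply: eq_bigr => i _; rewrite mxE.
Qed.

End CharacterSpace.

(** * Additive maps on free abelian groups and isomorphisms of based rings *)

Lemma fgliftD (K : choiceType) (V : lmodType int) (f : K -> V) :
  {morph fglift f : u v / u + v}.
Proof.
move=> u v; have fB := lift_is_additive f; have f0 : fglift f 0 = 0.
  by have := fB 0 0; rewrite !subrr.
have fN w : fglift f (- w) = - fglift f w by rewrite -[- w]sub0r fB f0 sub0r.
by rewrite -{1}[v]opprK fB fN opprK.
Qed.

Lemma fglift0 (K : choiceType) (V : lmodType int) (f : K -> V) : fglift f 0 = 0.
Proof. by have := lift_is_additive f 0 0; rewrite !subrr. Qed.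

Lemma fgliftU (K : choiceType) (V : lmodType int) (f : K -> V) k : fglift f << k >> = f k.
Proof. by rewrite liftU scale1r. Qed.

(** Additive maps respect integer multiples, and every element is a finite sum of multiples of
    generators. *)
Lemma freeg_additive_ext (K : choiceType) (V : zmodType) (f g : {freeg K / int} -> V) :
  {morph f : u v / u + v} -> {morph g : u v / u + v} ->
  (forall k, f << k >> = g << k >>) -> f =1 g.
Proof.
have mz (h : {freeg K / int} -> V) : {morph h : u v / u + v} ->
    h 0 = 0 /\ forall u m, h (u *~ m) = h u *~ m.
  move=> hD; have h0 : h 0 = 0 by apply: (addrI (h 0)); rewrite -hD !addr0.
  have hN u : h (- u) = - h u by apply: (addrI (h u)); rewrite -hD !subrr.
  split=> // u m; have hn (k : nat) : h (u *+ k) = h u *+ k.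
    by elim: k => [|k IH]; rewrite ?mulr0n // !mulrS hD IH.
  by case: m => k; rewrite ?NegzE ?mulrNz ?hN -!pmulrn hn.
move=> fD gD fg D; have [f0 fz] := mz f fD; have [g0 gz] := mz g gD.
rewrite -[D]freeg_sumE; elim: (dom D) => [|k s IH]; first by rewrite big_nil f0 g0.
by rewrite big_cons fD gD IH -[coeff k D]intz -freegU_mulz fz gz fg.
Qed.

Lemma ring_iso_sym (A B : based_ring) : ring_iso A B -> ring_iso B A.
Proof.
case=> f [[g fK gK] fD f1 fM]; exists g; split.
- by exists f.
- by move=> u v; apply: (can_inj fK); rewrite fD !gK.
- by rewrite -f1 fK.
- by move=> u v; apply: (can_inj fK); rewrite fM !gK.
Qed.

Lemma ring_iso_basis (A B : based_ring) (phi : A -> B) : bijective phi ->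
  phi (bone A) = bone B ->
  (forall a a', fglift (fun c => << phi c >>) (bmul a a') =
     bmul (phi a) (phi a') :> {freeg (basis B) / int}) ->
  ring_iso A B.
Proof.
case=> psi phiK psiK phi1 phiM.
pose f : {freeg (basis A) / int} -> {freeg (basis B) / int} := fglift (fun c => << phi c >>).
pose g : {freeg (basis B) / int} -> {freeg (basis A) / int} := fglift (fun c => << psi c >>).
have fD : {morph f : u v / u + v} := fgliftD _; have gD : {morph g : u v / u + v} := fgliftD _.
have fU a : f << a >> = << phi a >> by exact: fgliftU.
have gU b : g << b >> = << psi b >> by exact: fgliftU.
exists f; split=> //; last 2 first.
- by rewrite /rone fU phi1.
- move=> u v; rewrite /rmul; move: u; apply: freeg_additive_ext => [u w|u w|a].
  + by rewrite fgliftD fD.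
  + by rewrite fD fgliftD.
  rewrite fU !fgliftU; move: v; apply: freeg_additive_ext => [v w|v w|a'].
  + by rewrite fgliftD fD.
  + by rewrite fD fgliftD.
  rewrite fU !fgliftU; exact: phiM.
exists g; apply: freeg_additive_ext => // [u v|a].
- by rewrite fD gD.
- by rewrite fU gU phiK.
- by rewrite gD fD.
- by rewrite gU fU psiK.
Qed.

Lemma inj_surj_bijective (T U : Type) (f : T -> U) :
  injective f -> (forall y, exists x, f x = y) -> bijective f.
Proof.
by move=> finj /choice[g gK]; exists g => // x; apply: finj; rewrite gK.
Qed.

(** * Assembling the ring isomorphism from the two families of characters *)

Theorem corollary5p8 (F : closedFieldType) (L : leibnizType F)
    (charF0 : [pchar F] =i pred0)
    (solvL : solvable_leibniz L)
    (finLie : findim (canonical_lie L)) :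
  let n := ldim (abelianization (canonical_lie L)) in
  ring_iso (Gr_bi L) (group_ring 'rV[F]_n ⊛ group_ring 'rV[F]_n).
Proof.
move=> n; have [X [Xchar XD Xinj Xsurj]] := character_space finLie.
have X0 x : X 0 x = 0 by apply: (addrI (X 0 x)); rewrite -XD !addr0.
(* Vectors and kinds parametrize the irreducible classes; by [cls0] and [cls_inj] the two kinds meet
   exactly at [v = 0]. *)
pose cls v b : IrrBi L := irr_class (weight_bimod b (Xchar v)).
have cls0 b : cls 0 b = gr_one L.
  apply/irr_classP/iso_bimod_sym/weight_bimod_iso; first by rewrite /dim /=.
  by split=> x m; rewrite X0 ?mulr0 scale0r.
have cls_inj v w b c : cls v b = cls w c -> v = w /\ (b = c \/ v = 0).
  move=> /irr_classP/weight_bimod_inj[Xvw bc]; split; first exact: Xinj.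
  have [->|bnc] := eqVneq b c; [by left | right].
  apply: Xinj => x; move: (bc x) bnc; rewrite X0 -Xvw; case: (b) (c) => [] [] //=.
    by rewrite mul1r mul0r => ->.
  by rewrite mul1r mul0r => <-.
have cls_surj l : exists v b, cls v b = l.
  have [chi [b [hchi iso]]] := irr_bimod_weight charF0 solvL (irr_repr l).
  have [v vchi] := Xsurj chi hchi; exists v, b; rewrite -[l]irr_reprK.
  apply/irr_classP/iso_bimod_sym/(iso_bimod_trans iso)/weight_bimod_iso => //.
  by split=> x m; rewrite vchi.
have dim1 v b : dim (weight_bimod b (Xchar v)) = 1%N by rewrite /dim /=.
have cls_same v w b : gr_mul (cls v b) (cls w b) = << cls (v + w) b >>.
  rewrite gr_mul_class -bimod_class_irr; apply/bimod_class_iso.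
  have [act d1] := weight_tensor_same (dim1 v b) (dim1 w b)
    (weight_bimodP b (Xchar v)) (weight_bimodP b (Xchar w)) erefl.
  apply: weight_bimod_iso d1 _; case: act => l r.
  by split=> x m; rewrite ?l ?r XD.
have nz v : v != 0 -> exists x, X v x != 0.
  move=> v0; apply: contrapT => no; move/eqP: v0; apply; apply: Xinj => x.
  by rewrite X0; apply/eqP; apply: contrapT => /negP xn; apply: no; exists x.
have cls_mixed v w : v != 0 -> w != 0 -> gr_mul (cls v true) (cls w false) = 0.
  move=> v0 w0; rewrite gr_mul_class; apply/bimod_class0.
  exact: (weight_tensor_mixed (weight_bimodP true (Xchar v)) (weight_bimodP false (Xchar w))
    isT isT (nz _ v0) (nz _ w0)).
(* A basis map out of the product is a plain case analysis, so the inverse isomorphism is built. *)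
apply: ring_iso_sym.
pose R := group_ring 'rV[F]_n.
pose phi (c : circ_basis R R) : IrrBi L := match c with
  | None => gr_one L
  | Some (inl a) => cls (val a) true
  | Some (inr b) => cls (val b) false
  end.
(* For [a = 0], [circ_inl] gives the common unity, in agreement with [cls0]. *)
have phi_inl a : phi (circ_inl R a) = cls a true.
  rewrite /circ_inl; case: insubP => [u _ uE|] /=; first by rewrite uE.
  by rewrite negbK => /eqP ->; rewrite cls0.
have phi_inr a : phi (circ_inr R a) = cls a false.
  rewrite /circ_inr; case: insubP => [u _ uE|] /=; first by rewrite uE.
  by rewrite negbK => /eqP ->; rewrite cls0.
apply: (@ring_iso_basis (R ⊛ R) (Gr_bi L) phi) => //; last first.
  move=> [[a|a]|] [[b|b]|] /=; rewrite ?fglift0 ?fgliftU.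
  - by rewrite phi_inl cls_same.
  - by rewrite cls_mixed // (valP a, valP b).
  - by rewrite gr_mulC gr_mul1.
  - by rewrite gr_mulC cls_mixed // (valP a, valP b).
  - by rewrite phi_inr cls_same.
  - by rewrite gr_mulC gr_mul1.
  - by rewrite gr_mul1.
  - by rewrite gr_mul1.
  - by rewrite gr_mul1.
apply: inj_surj_bijective => [c d|l].
  case: c d => [[a|a]|] [[b|b]|] //=.
  - by move/cls_inj => -[/val_inj ->].
  (* A class of both kinds has character 0, which the subtype excludes. *)
  - by move/cls_inj => -[_ [//|a0]]; have := valP a; rewrite /= a0 eqxx.
  - by rewrite -(cls0 true) => /cls_inj[a0 _]; have := valP a; rewrite /= a0 eqxx.
  - by move/cls_inj => -[_ [//|a0]]; have := valP a; rewrite /= a0 eqxx.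
  - by move/cls_inj => -[/val_inj ->].
  - by rewrite -(cls0 true) => /cls_inj[a0 _]; have := valP a; rewrite /= a0 eqxx.
  - by rewrite -(cls0 true) => /cls_inj[/esym b0 _]; have := valP b; rewrite /= b0 eqxx.
  - by rewrite -(cls0 true) => /cls_inj[/esym b0 _]; have := valP b; rewrite /= b0 eqxx.
have [v [[] <-]] := cls_surj l; first by exists (circ_inl R (v : R)); rewrite phi_inl.
by exists (circ_inr R (v : R)); rewrite phi_inr.
Qed.
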